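(* Let $(\Omega,\mathcal F,\mu,T)$ be a probability preserving dynamical system, $\tau:\Omega\to(0,+\infty)$ an integrable function with $\bar\tau:=\int_\Omega\tau\,d\mu$, and let $(\mathcal M,\mathcal T,\nu,(Y_t)_t)$ be the special flow over $(\Omega,\mathcal F,\mu,T)$ with roof function $\tau$, with projection $\Pi:\mathcal M\to\Omega$, $\Pi(x,t)=x$. Let $(\mathcal A_\varepsilon)_\varepsilon$ be a family of subsets of $\mathcal M$ such that $A_\varepsilon:=\Pi\mathcal A_\varepsilon$ is measurable with $\mu(A_\varepsilon)\to0+$ as $\varepsilon\to0$. Let $V$ be a locally compact metric space with Borel $\sigma$-algebra $\mathcal V$ and let $H_\varepsilon:A_\varepsilon\to V$ be measurable functions. Assume that the point processes $$\mathcal N_\varepsilon(x)=\sum_{n\ge1\,:\,T^n(x)\in A_\varepsilon}\delta_{(n\mu(A_\varepsilon),H_\varepsilon(T^n(x)))}$$ on $[0,+\infty)\times V$ converge in distribution, with respect to some probability measure $\tilde\mu\ll\mu$, to a Poisson point process of intensity $\lambda\times m$, where $m$ is some measure on $(V,\mathcal V)$. Then the family of point processes $$\mathfrak N_\varepsilon(y):=\sum_{t>0\,:\,Y_t(y)\in A_\varepsilon\times\{0\}}\delta_{(t\mu(A_\varepsilon)/\bar\tau,\;H_\varepsilon(\Pi Y_t(y)))},\qquad y\in\mathcal M,$$ converges strongly in distribution to a Poisson point process of intensity $\lambda\times m$.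
   Context: $\lambda$ is Lebesgue measure on $[0,\infty)$. The special flow: $\mathcal M:=\{(x,t)\in\Omega\times[0,+\infty): t<\tau(x)\}$, $\mathcal T$ is the trace on $\mathcal M$ of $\mathcal F\otimes\mathcal B([0,+\infty))$, $\nu$ is the restriction to $\mathcal M$ of $(\mu\times\lambda)/\bar\tau$, and $Y_s(x,t)=(x,t+s)$ with the identification $(x,\tau(x))\equiv(T(x),0)$, i.e. $$Y_s(x,t)=\Big(T^{n_s(x,t)}(x),\ t+s-\sum_{k=0}^{n_s(x,t)-1}\tau\circ T^k(x)\Big),\quad n_s(x,t):=\sup\Big\{n:\sum_{k=0}^{n-1}\tau\circ T^k(x)\le t+s\Big\}.$$ With $E=[0,+\infty)\times V$, $M_p(E)$ is the space of point measures on $E$ with the topology of vague convergence (metrizable as a complete separable metric space). Point processes converge in distribution, $\mathcal N_\varepsilon\to\mathcal N$, if $\mathbb E(f(\mathcal N_\varepsilon))\to\mathbb E(f(\mathcal N))$ for every bounded continuous $f:M_p(E)\to\mathbb R$. ''Strongly in distribution'' here means: convergence in distribution when $y$ is distributed according to any probability measure absolutely continuous with respect to $\nu$. A Poisson point process of intensity $\eta$ is a point process giving independent Poisson counts with parameters $\eta(B_i)$ to pairwise disjoint Borel sets $B_i\subset E$.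
   Formalization: The dynamical system is additionally assumed ergodic, since the claim fails otherwise (e.g. μ̃ carried by an invariant component that A_ε never meets, m = 0); V is also taken second countable, as the separability of M_p(E) implies. *)

(* Defs.v *)
From HB Require Import structures.
From mathcomp Require Import all_boot all_order all_algebra.
From mathcomp Require Import all_classical all_reals all_analysis measurable_realfun.

Set Implicit Arguments.
Unset Strict Implicit.
Unset Printing Implicit Defensive.

Import Order.TTheory GRing.Theory Num.Theory.
Import numFieldNormedType.Exports.

Local Open Scope classical_set_scope.
Local Open Scope ring_scope.

(* Measurable types are pointed in the library, hence a metric space that is to
   carry its Borel sigma-algebra must be pointed too. *)
#[short(type="pmetricType")]
HB.structure Definition PointedMetric (K : numDomainType) :=
  {M of Metric K M & Pointed M}.

Notation borel X := (g_sigma_algebraType (@open X)).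

Section DynamicalSystem.
Context d (Om : measurableType d) (R : realType) (mu : probability Om R).
Implicit Type T : Om -> Om.

Definition measure_preserving T :=
  measurable_fun setT T /\
  forall A, measurable A -> mu (T @^-1` A) = mu A.

Definition ergodic T :=
  forall A, measurable A -> T @^-1` A = A -> mu A = 0%E \/ mu A = 1%E.

End DynamicalSystem.

Section PointMeasures.
Context (E : ptopologicalType) (R : realType).

(* Countable sum of Dirac masses (with multiplicity), finite on compact sets.
   It is a function on all subsets of E, so that, when points are closed, two
   point measures that agree on the Borel sets are equal. *)
Definition is_point_measure (N : set E -> \bar R) :=
  (exists (D : set nat) (z : nat -> E),
     N = fun B => (\esum_(i in D) (\d_(z i : borel E) B))%E) /\
  (forall K, compact K -> (N K < +oo)%E).

Record point_measure := PointMeasure {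
  pm_fun :> set E -> \bar R;
  pm_prop : is_point_measure pm_fun }.

HB.instance Definition _ := gen_eqMixin point_measure.
HB.instance Definition _ := gen_choiceMixin point_measure.

Record test_function := TestFunction {
  test_fun :> E -> R;
  test_continuous : continuous test_fun;
  test_compact : compact (closure [set z | test_fun z != 0]) }.

HB.instance Definition _ := gen_eqMixin test_function.
HB.instance Definition _ := gen_choiceMixin test_function.

Definition pm_integral (N : point_measure) (f : test_function) : R :=
  fine (\int[(N : set (borel E) -> \bar R)]_z (f z)%:E).

(* The vague topology is the coarsest one making N |-> \int f dN continuous for
   every continuous f with compact support. *)
HB.instance Definition _ := Topological.copy point_measure
  (initial_topology (pm_integral : point_measure -> {ptws test_function -> R})).

Lemma is_point_measure0 : is_point_measure (fun=> 0%E).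
Proof.
split=> [|K _]; last by rewrite ltry.
by exists set0, (fun=> point); apply/funext => B; rewrite esum_set0.
Qed.

(* The formulas below for the point processes make sense for every point of the
   base space, but give a locally finite measure only almost everywhere; on the
   exceptional set the process is set to the null measure. *)
Definition to_point_measure (N : set E -> \bar R) : point_measure :=
  if pselect (is_point_measure N) is left h then PointMeasure h
  else PointMeasure is_point_measure0.

End PointMeasures.

Section Convergence.
Context (E : ptopologicalType) (R : realType).

Definition cvg_in_distribution
    d (Om : measurableType d) (P : probability Om R)
    (N : R -> Om -> point_measure E R)
    d' (Om' : measurableType d') (Q : probability Om' R)
    (N0 : Om' -> point_measure E R) :=
  forall F : point_measure E R -> R,
    continuous F -> (exists M, forall p, `|F p| <= M) ->
    ('E_P[F \o N e])%E @[e --> 0^'+] --> ('E_Q[F \o N0])%E.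

Definition cvg_strongly_in_distribution
    d (Om : measurableType d) (nu : set Om -> \bar R)
    (N : R -> Om -> point_measure E R)
    d' (Om' : measurableType d') (Q : probability Om' R)
    (N0 : Om' -> point_measure E R) :=
  forall rho : probability Om R, rho `<< nu -> cvg_in_distribution rho N Q N0.

Context d (Om : measurableType d) (Q : probability Om R).

Definition mutually_independent n (X : 'I_n -> Om -> \bar R) :=
  forall C : 'I_n -> set (\bar R), (forall i, measurable (C i)) ->
    Q (\bigcap_i (X i @^-1` C i)) = (\prod_(i < n) Q (X i @^-1` C i))%E.

(* The library's poisson_pmf is not used: at rate 0 it is the constant 1. *)
Definition poisson_law (X : Om -> \bar R) (a : \bar R) :=
  if a is r%:E then
    forall k : nat, Q (X @^-1` [set k%:R%:E]) =
                    (r ^+ k / k`!%:R * expR (- r))%:E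
  else Q (X @^-1` [set +oo%E]) = 1%E.

Definition poisson_point_process (N : Om -> point_measure E R)
    (eta : set E -> \bar R) :=
  (forall B : set (borel E), measurable B ->
     measurable_fun setT (fun w => N w B) /\
     poisson_law (fun w => N w B) (eta B)) /\
  (forall n (B : 'I_n -> set (borel E)), (forall i, measurable (B i)) ->
     trivIset setT B -> mutually_independent (fun i w => N w (B i))).

End Convergence.

Section SpaceTime.
Context (R : realType).

Definition half_line : Type := set_type (`[0%R, +oo[%classic : set R).

HB.instance Definition _ := SubChoice.on half_line.
HB.instance Definition _ := Topological.on half_line.

Lemma half_line0 : (0 : R) \in (`[0%R, +oo[%classic : set R).
Proof. by rewrite inE /= in_itv /= lexx. Qed.

HB.instance Definition _ :=
  isPointed.Build half_line (exist _ (0 : R) half_line0).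

(* the identity on nonnegative reals *)
Definition to_half_line (t : R) : half_line := insubd (point : half_line) t.

Definition space_time (V : ptopologicalType) := (half_line * V)%type.

HB.instance Definition _ (V : ptopologicalType) :=
  Topological.on (space_time V).
HB.instance Definition _ (V : ptopologicalType) := Pointed.on (space_time V).

(* lambda \x m, the product being computed in R * V *)
Definition space_time_intensity (V : ptopologicalType)
    (m : set (borel V) -> \bar R) (B : set (space_time V)) : \bar R :=
  (lebesgue_measure \x m)%E
    ((fun z : space_time V => (set_val z.1 : measurableTypeR R, z.2 : borel V))
       @` B).

End SpaceTime.

Section SpecialFlow.
Context d (Om : measurableType d) (R : realType) (mu : probability Om R).
Variables (T : Om -> Om) (tau : Om -> R).

Definition mean_roof : R := \int[mu]_x tau x.

Definition birkhoff_sum (n : nat) (x : Om) : R :=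
  \sum_(k < n) tau (iter k T x).

Definition flow_space : set (Om * R) :=
  [set y | 0 <= y.2 < tau y.1].

(* nu, seen as a measure on Om * R carried by flow_space *)
Definition flow_measure (B : set (Om * measurableTypeR R)) : \bar R :=
  ((mean_roof^-1)%:E *
     (mu \x lebesgue_measure) (B `&` flow_space))%E.

(* The set below is finite for almost every y; the supremum is 0 when it is
   not bounded. *)
Definition flow_count (s : R) (y : Om * R) : nat :=
  supremum 0%N [set n | birkhoff_sum n y.1 <= y.2 + s].

Definition special_flow (s : R) (y : Om * R) : Om * R :=
  let n := flow_count s y in
  (iter n T y.1, y.2 + s - birkhoff_sum n y.1).

Context (V : ptopologicalType).
Variables (A : set Om) (H : Om -> V).

Definition base_process (x : Om) : point_measure (space_time R V) R :=
  let z n : borel (space_time R V) :=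
    (to_half_line (n%:R * fine (mu A)), H (iter n T x)) in
  to_point_measure (fun B =>
    (\esum_(n in [set n : nat | (1 <= n)%N /\ A (iter n T x)]) \d_(z n) B)%E).

Definition flow_process (y : Om * R) : point_measure (space_time R V) R :=
  let z t : borel (space_time R V) :=
    (to_half_line (t * fine (mu A) / mean_roof), H (special_flow t y).1) in
  let hits : set R := [set t | 0 < t /\ (A `*` [set 0]) (special_flow t y)] in
  to_point_measure (fun B => (\esum_(t in hits) \d_(z t) B)%E).

End SpecialFlow.

(* Main.v *)
From HB Require Import structures.
Require Import Defs.
From mathcomp Require Import all_boot all_order all_algebra.
From mathcomp Require Import all_classical all_reals all_analysis measurable_realfun.
From mathcomp Require Import ring lra.

Set Implicit Arguments.
Unset Strict Implicit.
Unset Printing Implicit Defensive.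

Import Order.TTheory GRing.Theory Num.Theory.
Import numFieldNormedType.Exports.

Local Open Scope classical_set_scope.
Local Open Scope ring_scope.

(* The vague topology on point measures is generated by the integrals of a
   countable family of test functions that are Lipschitz in time.  Hence every
   bounded continuous functional is a pointwise limit, from below and from above,
   of functionals that are Lipschitz in finitely many of these integrals, and it
   suffices to treat the latter.
   On the base, the process at [T x] is the process at [x] shifted in time by
   [mu A] and stripped of one possible point, so that the two differ by a
   quantity of order [mu A] in L1.  Bounded observables that are asymptotically
   invariant have asymptotically the same mean under all probabilities
   absolutely continuous with respect to [mu] (Zweimueller): this follows from
   the mean ergodic theorem applied to the density.
   On the flow, the hits of [(x, t)] occur at the times [S_n x - t] with
   [T^n x] in [A], where [S_n] is the Birkhoff sum of the roof.  As [S_n / n]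
   tends to the mean roof, the rescaled hitting times are uniformly close to
   [n (mu A)] on bounded time intervals, which carry a bounded expected number
   of points. *)

(** * Integration on a probability space *)

(** Convergence is carried along a chain of laws: from [mut] to [mu], from [mu] to the base marginal
    of [rho], and then from the base process to the flow process under [rho] itself. The first two
    links compare integrals only; the last compares the two processes point by point, outside a set
    of small [rho]-measure. The bound on the number of points is an expectation under [mu], which
    reaches [rho] through Markov's inequality and the absolute continuity of the marginal.
    Measurability shapes the passage to general functionals: a continuous functional of the flow
    process is not shown to be a measurable function of the starting point. Integrals of such
    functions are handled by monotonicity, which is why approximants are required on both sides. The
    vague topology is never metrized: the pseudo-distances [pm_dist], built from finitely many
    integrals, take the place of a metric. The thresholds on [mu A] are chosen before [A] and [H],
    so that they serve all small parameters at once. *)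

Section IntegralMonotone.
Context d (T : measurableType d) (R : realType).

Lemma le_integral_all (mu : set T -> \bar R) (D : set T) (f g : T -> \bar R) :
  (forall x, (f x <= g x)%E) ->
  (\int[mu]_(x in D) f x <= \int[mu]_(x in D) g x)%E.
Proof.
move=> fg; have fgD x : ((f \_ D) x <= (g \_ D) x)%E by rewrite /patch; case: ifP.
rewrite /integral; apply: leeB; apply: ereal_sup_le => _ [h hf <-];
  exists h => // x; apply: (le_trans (hf x)).
  by rewrite !funeposE le_max2.
by rewrite !funenegE le_max2// leeN2.
Qed.

Context (P : probability T R).

Lemma bounded_integrable (f : T -> R) M : measurable_fun setT f ->
  (forall x, `|f x| <= M) -> P.-integrable setT (EFin \o f).
Proof.
move=> mf fM; apply: measurable_bounded_integrable => //.
  by rewrite (le_lt_trans (probability_le1 _ _)) ?ltry.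
by exists M; split; [exact: num_real|move=> x Mx y _; exact: le_trans (fM y) (ltW Mx)].
Qed.

Lemma integral_cst_prob (c : R) : (\int[P]_x c%:E)%E = c%:E.
Proof.
transitivity (c%:E * P setT)%E; first exact: integral_cst.
by rewrite probability_setT mule1.
Qed.

Lemma le_abse_integral_bounded (f : T -> R) M : (forall x, `|f x| <= M) ->
  (- M%:E <= \int[P]_x (f x)%:E <= M%:E)%E.
Proof.
move=> fM; apply/andP; split.
  rewrite -EFinN -(integral_cst_prob (- M)); apply: le_integral_all => x.
  by rewrite lee_fin; have := fM x; rewrite ler_norml => /andP[].
rewrite -(integral_cst_prob M); apply: le_integral_all => x.
by rewrite lee_fin (le_trans (ler_norm _)).
Qed.

Lemma bounded_integral_fin_num (f : T -> R) M : (forall x, `|f x| <= M) ->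
  (\int[P]_x (f x)%:E)%E \is a fin_num.
Proof.
move=> /le_abse_integral_bounded /andP[h1 h2].
by rewrite fin_numE -ltNye -ltey (lt_le_trans _ h1) ?(le_lt_trans h2) ?ltry// ltNyr.
Qed.

Lemma le_Rintegral_all (f g : T -> R) M : (forall x, `|f x| <= M) ->
  (forall x, `|g x| <= M) -> (forall x, f x <= g x) ->
  \int[P]_x f x <= \int[P]_x g x.
Proof.
move=> fM gM fg; rewrite /Rintegral fine_le ?(bounded_integral_fin_num fM)
  ?(bounded_integral_fin_num gM)//.
by apply: le_integral_all => x; rewrite lee_fin.
Qed.

Lemma Rintegral_abs_le (f : T -> R) M : (forall x, `|f x| <= M) ->
  `|\int[P]_x f x| <= M.
Proof.
move=> fM; have /andP[h1 h2] := le_abse_integral_bounded fM.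
have ffin := bounded_integral_fin_num fM.
by rewrite ler_norml /Rintegral -!lee_fin fineK// EFinN h1.
Qed.

(* [f] is not assumed measurable: by its definition as a supremum over simple
   functions, the integral is monotone on all functions. *)
Lemma Rintegral_close (f g : T -> R) (M e : R) (B : set T) :
  measurable B -> measurable_fun setT g -> 0 <= e ->
  (forall x, `|f x| <= M) -> (forall x, `|g x| <= M) ->
  (forall x, ~ B x -> `|f x - g x| <= e) ->
  `|\int[P]_x f x - \int[P]_x g x| <= e + 2 * M * fine (P B).
Proof.
move=> mB mg e0 fM gM fg.
have M0 : 0 <= M by rewrite (le_trans _ (gM point)).
(* [f] is squeezed between the measurable functions [g - r] and [g + r]; linearity of the integral
   is used for [g] and [r] only. *)
pose r x := e + 2 * M * \1_B x.
have r0 x : 0 <= r x by rewrite addr_ge0// mulr_ge0// mulr_ge0.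
have rM x : `|r x| <= e + 2 * M.
  by rewrite ger0_norm// /r lerD2l indicE; case: (_ \in _); rewrite ?mulr1// mulr0 mulr_ge0.
have mr : measurable_fun setT r.
  by apply: measurable_funD => //; apply: measurable_funM.
have intr : \int[P]_x r x = e + 2 * M * fine (P B).
  rewrite RintegralD//; last 2 first.
  - by apply: (@bounded_integrable _ `|e|).
  - apply: (@bounded_integrable _ `|2 * M|) => [|x]; first exact: measurable_funM.
    rewrite normrM indicE; case: (_ \in _); rewrite ?normr1 ?mulr1// normr0 mulr0//.
  rewrite RintegralZl//; last first.
    apply: (@bounded_integrable _ 1) => // x.
    by rewrite indicE; case: (_ \in _); rewrite ?normr1// normr0.
  rewrite /Rintegral integral_cst_prob integral_indic//= setIT//.
have frg x : `|f x - g x| <= r x.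
  rewrite /r indicE; have [xB|xB] := boolP (x \in B).
    rewrite mulr1 (le_trans (ler_normB _ _))//.
    by have := fM x; have := gM x; lra.
  by rewrite mulr0 addr0; apply: fg => Bx; rewrite mem_set in xB.
have gI : P.-integrable setT (EFin \o g) by exact: (@bounded_integrable _ M).
have rI : P.-integrable setT (EFin \o r) by exact: (@bounded_integrable _ (e + 2 * M)).
pose M' := M + (e + 2 * M).
have fM' x : `|f x| <= M' by rewrite (le_trans (fM x))// lerDl addr_ge0// mulr_ge0.
have h1 : \int[P]_x f x <= \int[P]_x (g x + r x).
  apply: (@le_Rintegral_all _ _ M') => // x.
    by rewrite (le_trans (ler_normD _ _))// lerD.
  by rewrite -lerBlDl (le_trans (ler_norm _)).
have h2 : \int[P]_x (g x - r x) <= \int[P]_x f x.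
  apply: (@le_Rintegral_all _ _ M') => // x.
    by rewrite (le_trans (ler_normB _ _))// lerD.
  by rewrite lerBlDl -lerBlDr (le_trans _ (frg x))// distrC ler_norm.
rewrite -intr ler_norml lerBlDl -RintegralD// h1 andbT.
by rewrite lerBrDl -RintegralB.
Qed.

End IntegralMonotone.

Section Exhaustion.
Context d (T : measurableType d) (R : realType) (P : probability T R).

(** Continuity from above: the complements decrease to a subset of the null set [N]. This turns an
    almost sure bound whose constant depends on the point into a bound with one constant off a small
    set. *)
Lemma exhaustion_small (W : nat -> set T) (N : set T) :
  (forall n, measurable (W n)) -> measurable N -> P N = 0%E ->
  {homo W : n m / (n <= m)%N >-> n `<=` m} ->
  (forall x, ~ N x -> exists n, W n x) ->
  forall e : R, 0 < e -> exists n, fine (P (~` W n)) < e.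
Proof.
move=> mW mN N0 ndW cW e e0.
have mWC n : measurable (~` W n) by exact: measurableC.
have cvgW : (P \o (fun n => ~` W n)) n @[n --> \oo] --> P (\bigcap_n ~` W n).
  apply: nonincreasing_cvg_mu => //.
  - by rewrite (le_lt_trans (probability_le1 _ _))// ltry.
  - exact: bigcap_measurableType.
  - by move=> n m nm; apply/subsetPset; apply: subsetC; exact: ndW.
have P0 : P (\bigcap_n ~` W n) = 0%E.
  apply/eqP; rewrite -measure_le0 -N0 le_measure ?inE//.
    exact: bigcap_measurableType.
  move=> x xW; apply: contrapT => /cW[n Wn].
  exact: xW Wn.
rewrite P0 in cvgW.
have /fine_cvgP[_ /cvgrPdist_lt /(_ _ e0)[n _ /(_ n (leqnn n))]] := cvgW.
by rewrite /= sub0r normrN => /(le_lt_trans (ler_norm _)) ?; exists n.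
Qed.

Lemma prob_fin_num (A : set T) : measurable A -> P A \is a fin_num.
Proof. by move=> mA; rewrite fin_num_measure. Qed.

End Exhaustion.

(** * Densities and uniform absolute continuity *)

Section AbsolutelyContinuous.
Context d (T : measurableType d) (R : realType).

Variables (mu nu : probability T R).
Hypothesis numu : nu `<< mu.

Lemma density_exists : exists u : T -> R,
  [/\ mu.-integrable setT (EFin \o u),
      (forall (f : T -> R) (M : R), measurable_fun setT f -> (forall x, `|f x| <= M) ->
        \int[nu]_x f x = \int[mu]_x (f x * u x)) &
      (forall A, measurable A -> fine (nu A) = \int[mu]_(x in A) u x)].
Proof.
set D := Radon_Nikodym (charge_of_finite_measure nu) mu.
have Dfin x : D x \is a fin_num by exact: Radon_Nikodym_fin_num.
have DE x : D x = (fine (D x))%:E by rewrite fineK.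
exists (fine \o D); split.
- have -> : EFin \o (fine \o D) = D by apply/funext => x /=; rewrite -DE.
  exact: Radon_Nikodym_integrable.
- move=> f M mf fM; rewrite /Rintegral; congr fine.
  rewrite -(Radon_Nikodym_change_of_variables numu)//; last first.
    exact: bounded_integrable fM.
  by apply: eq_integral => x _; rewrite EFinM -DE.
- move=> A mA; rewrite /Rintegral; congr fine.
  transitivity (charge_of_finite_measure nu A) => //.
  transitivity (\int[mu]_(x in A) D x)%E; first exact: Radon_Nikodym_integral.
  by apply: eq_integral => x _ /=; rewrite -DE.
Qed.

Lemma abs_cont_small (e : R) : 0 < e -> exists2 dl, 0 < dl &
  forall A, measurable A -> fine (mu A) < dl -> fine (nu A) < e.
Proof.
move=> e0; have [u [ui _ nuE]] := density_exists.
have [dl [dl0 h]] := integral_normr_continuous ui e0.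
exists dl => // A mA Adl; rewrite nuE//.
have uA : mu.-integrable A (EFin \o u) by exact: (integrableS measurableT).
apply: (le_lt_trans (ler_norm _)).
apply: (le_lt_trans (le_normr_Rintegral mA uA)); apply: h => //.
have := prob_fin_num mu mA; move: Adl.
change (fine (mu A) < dl -> mu A \is a fin_num -> (mu A < dl%:E)%E).
by case: (mu A).
Qed.

End AbsolutelyContinuous.

(** * Birkhoff's ergodic theorem *)

Section MeasurePreserving.
Context d (Om : measurableType d) (R : realType) (mu : probability Om R).
Variable T : Om -> Om.
Hypothesis hT : measure_preserving mu T.

Lemma measurable_iter n : measurable_fun setT (iter n T).
Proof.
elim: n => [|n ih]; first exact: measurable_id.
by apply: measurableT_comp ih; exact: hT.1.
Qed.

Lemma measure_preimage_iter n (A : set Om) :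
  measurable A -> mu (iter n T @^-1` A) = mu A.
Proof.
move=> mA; elim: n => [//|n ih] in A mA *.
have mTA : measurable (T @^-1` A) by rewrite -[_ @^-1` _]setTI; exact: hT.1.
by transitivity (mu (T @^-1` A)); [exact: (ih (T @^-1` A))|exact: hT.2].
Qed.

Lemma measurable_preimage_iter n (A : set Om) :
  measurable A -> measurable (iter n T @^-1` A).
Proof. by move=> mA; rewrite -[_ @^-1` _]setTI; exact: measurable_iter. Qed.

Lemma ge0_integral_measure_preserving (f : Om -> \bar R) :
  measurable_fun setT f -> (forall x, 0 <= f x)%E ->
  (\int[mu]_x f (T x) = \int[mu]_x f x)%E.
Proof.
move=> mf f0; have mT := hT.1.
transitivity (\int[pushforward mu T]_x f x)%E.
  by rewrite ge0_integral_pushforward.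
apply: eq_measure_integral => A mA _; exact: hT.2.
Qed.

Lemma integrable_measure_preserving (f : Om -> R) :
  mu.-integrable setT (EFin \o f) -> mu.-integrable setT (EFin \o (f \o T)).
Proof.
move=> /integrableP[mf fi]; apply/integrableP; split.
  by apply: measurableT_comp mf _; exact: hT.1.
rewrite (ge0_integral_measure_preserving (f := fun x => `|(f x)%:E|%E))//.
exact: measurableT_comp.
Qed.

Lemma Rintegral_measure_preserving (f : Om -> R) :
  measurable_fun setT f -> \int[mu]_x f (T x) = \int[mu]_x f x.
Proof.
move=> mf; rewrite /Rintegral; congr fine; rewrite integralE [RHS]integralE.
have mf' : measurable_fun setT (EFin \o f) by exact/measurable_EFinP.
congr (_ - _)%E.
  rewrite -(ge0_integral_measure_preserving (measurable_funepos mf'))//.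
  by apply: eq_integral => x _; rewrite !funeposE.
rewrite -(ge0_integral_measure_preserving (measurable_funeneg mf'))//.
by apply: eq_integral => x _; rewrite !funenegE.
Qed.

End MeasurePreserving.

(** * Birkhoff's theorem through the maximal sums of Garsia *)

Section Birkhoff.
Context d (Om : measurableType d) (R : realType) (mu : probability Om R).
Variable T : Om -> Om.
Hypotheses (hT : measure_preserving mu T) (herg : ergodic mu T).

Lemma birkhoff_sumS (f : Om -> R) n x :
  birkhoff_sum T f n.+1 x = f x + birkhoff_sum T f n (T x).
Proof.
rewrite /birkhoff_sum big_ord_recl/=; congr (_ + _).
by apply: eq_bigr => i _; rewrite -iterS iterSr.
Qed.

Lemma measurable_birkhoff_sum (f : Om -> R) n :
  measurable_fun setT f -> measurable_fun setT (birkhoff_sum T f n).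
Proof.
move=> mf; apply: measurable_sum => i; apply: measurableT_comp mf _.
exact: measurable_iter hT _.
Qed.

(** The maximum of the Birkhoff sums of lengths 0 to [n], written recursively so that comparison
    with its own composition with [T] is immediate. *)
Fixpoint max_birkhoff (f : Om -> R) n x : R :=
  if n is n'.+1 then Num.max 0 (f x + max_birkhoff f n' (T x)) else 0.

Lemma max_birkhoff_ge0 f n x : 0 <= max_birkhoff f n x.
Proof. by case: n => [//|n] /=; rewrite le_max lexx. Qed.

Lemma max_birkhoff_nd f x : {homo max_birkhoff f ^~ x : m n / (m <= n)%N >-> m <= n}.
Proof.
apply: homo_leq => //; first by move=> ? ? ?; exact: le_trans.
move=> n; elim: n x => [|n ih] x; first exact: max_birkhoff_ge0.
by apply: le_max2 => //; rewrite lerD2l; exact: ih.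
Qed.

Lemma birkhoff_sum_le_max f n x : birkhoff_sum T f n x <= max_birkhoff f n x.
Proof.
elim: n x => [|n ih] x; first by rewrite /birkhoff_sum big_ord0.
by rewrite birkhoff_sumS /= le_max lerD2l ih orbT.
Qed.

Lemma max_birkhoff_integrable (f : Om -> R) n :
  mu.-integrable setT (EFin \o f) ->
  mu.-integrable setT (EFin \o max_birkhoff f n).
Proof.
move=> fi; elim: n => [|n ih]; first exact: integrable0.
have gi : mu.-integrable setT (EFin \o (fun x => f x + max_birkhoff f n (T x))).
  rewrite (_ : _ \o _ = (EFin \o f) \+ (EFin \o (max_birkhoff f n \o T)))%E//.
  by apply: integrableD => //; exact: integrable_measure_preserving.
apply: (le_integrable _ _ _ gi) => //.
  apply/measurable_EFinP; apply: measurable_maxr => //.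
  by apply/measurable_EFinP; case/integrableP: gi.
move=> x _ /=; rewrite lee_fin ger0_norm ?le_max ?lexx//.
by rewrite ge_max normr_ge0 ler_norm.
Qed.

(** The set [E] where the sums are unbounded above is invariant, so it is null or full. If it were
    full, the differences [dn n] of [max_birkhoff f n.+1] and [max_birkhoff f n \o T] would have
    nonnegative integrals, by invariance of [mu] and monotonicity in [n], and would converge to [f]
    under the bound [|f|]; the integral of [f] could not be negative. *)
Lemma birkhoff_sum_ae_bounded (f : Om -> R) :
  mu.-integrable setT (EFin \o f) -> \int[mu]_x f x < 0 ->
  exists2 N : set Om, measurable N /\ mu N = 0%E &
    forall x, ~ N x -> exists C : nat, forall n, birkhoff_sum T f n x <= C%:R.
Proof.
move=> fi fneg.
have mf : measurable_fun setT f by apply/measurable_EFinP; case/integrableP: fi.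
pose E := \bigcap_(C : nat) \bigcup_n [set x | C%:R < birkhoff_sum T f n x].
have mE : measurable E.
  apply: bigcap_measurableType => C _; apply: bigcup_measurable => n _.
  rewrite -[X in measurable X]setTI; apply: measurable_fun_ltr => //.
  exact: measurable_birkhoff_sum.
have TE : T @^-1` E = E.
  apply/seteqP; split => x /= Ex C _.
    (* Passing from [T x] to [x] changes the sums by [f x], so the level is raised by an integer
       above [|f x|]. *)
    pose C' := (C + (Num.truncn `|f x|).+1)%N.
    have [n _ /= h] := Ex C' Logic.I; exists n.+1 => //=.
    rewrite birkhoff_sumS; have h2 := truncnS_gt `|f x|.
    move: h; rewrite /C' natrD => h; have := ler_norm (- f x); rewrite normrN.
    lra.
  pose C' := (C + (Num.truncn `|f x|).+1)%N.
  have [[|n] _ /= h] := Ex C' Logic.I.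
    by move: h; rewrite /birkhoff_sum big_ord0 ltNge ler0n.
  exists n => //=; move: h; rewrite birkhoff_sumS /C' natrD => h.
  have h2 := truncnS_gt `|f x|; have := ler_norm (f x); lra.
exists E; last first.
  move=> x /existsNP[C /not_implyP[_ hC]]; exists C => n.
  by rewrite leNgt; apply/negP => h; apply: hC; exists n.
split=> //; have [//|E1] := herg mE TE; exfalso; move: fneg; apply/negP.
rewrite -leNgt.
pose dn n x := max_birkhoff f n.+1 x - max_birkhoff f n (T x).
have Mi n := max_birkhoff_integrable n fi.
have mM n : measurable_fun setT (max_birkhoff f n).
  by apply/measurable_EFinP; case/integrableP: (Mi n).
have MTi n := integrable_measure_preserving hT (Mi n).
have mdn n : measurable_fun setT (dn n).
  apply: measurable_funB => //; apply: measurableT_comp (mM n) _; exact: hT.1.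
have dn_ge0 n : 0 <= \int[mu]_x dn n x.
  have -> : \int[mu]_x dn n x = \int[mu]_x max_birkhoff f n.+1 x - \int[mu]_x max_birkhoff f n x.
    rewrite -(Rintegral_measure_preserving hT (mM n)).
    exact: (RintegralB measurableT (Mi n.+1) (MTi n)).
  rewrite subr_ge0.
  by apply: le_Rintegral => // x _; exact: max_birkhoff_nd.
have NE0 : mu (~` E) = 0%E.
  by rewrite probability_setC// E1 subee.
have [] := @dominated_convergence _ _ _ mu setT measurableT
    (fun n => EFin \o dn n) (EFin \o f) (EFin \o (fun x => `|f x|)).
- by move=> n; exact/measurable_EFinP.
- exact/measurable_EFinP.
- exists (~` E); split => //; first exact: measurableC.
  move=> x /= nx Ex; apply: nx => _.
  apply: cvg_near_cst.
  (* On [E] the maximal sum at [T x] eventually exceeds [|f x|]; the maximum with 0 is then inactive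
     and [dn n x] equals [f x]. *)
  have /(_ (Num.truncn `|f x|).+1 Logic.I)[n0 _ /= hn0] : (T @^-1` E) x by rewrite TE.
  exists n0 => // n /= n0n; congr EFin.
  have le1 := le_trans (birkhoff_sum_le_max f n0 (T x)) (max_birkhoff_nd f (T x) n0n).
  have h2 := truncnS_gt `|f x|; have := ler_norm (- f x); rewrite normrN => h3.
  rewrite /dn /= max_r; first by rewrite addrK.
  lra.
- exact: integrable_norm.
- apply: nearW => x n _ /=; rewrite lee_fin /dn /=.
  have := max_birkhoff_ge0 f n (T x).
  set m := max_birkhoff _ _ _ => m0; rewrite maxElt; case: ltP => h; rewrite ler_norml.
    by have := ler_norm (f x); have := ler_norm (- f x); rewrite normrN; lra.
  by have := ler_norm (f x); have := ler_norm (- f x); rewrite normrN; lra.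
move=> _ _ cvgd; rewrite /Rintegral fine_ge0//.
rewrite -(cvg_lim _ cvgd)//; apply: lime_ge; first by apply/cvg_ex; eexists; exact: cvgd.
apply: nearW => n /=; have dfin : (\int[mu]_x (dn n x)%:E)%E \is a fin_num.
  apply: integrable_fin_num => //.
  exact: (integrableB measurableT (Mi n.+1) (MTi n)).
rewrite -(fineK dfin) lee_fin; exact: dn_ge0.
Qed.

Lemma birkhoff_sumN (f : Om -> R) n x :
  birkhoff_sum T (\- f) n x = - birkhoff_sum T f n x.
Proof. by rewrite /birkhoff_sum -sumrN. Qed.

Lemma birkhoff_sumBcst (f : Om -> R) c n x :
  birkhoff_sum T (fun y => f y - c) n x = birkhoff_sum T f n x - n%:R * c.
Proof.
rewrite /birkhoff_sum sumrB; congr (_ - _).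
by rewrite sumr_const card_ord mulr_natl.
Qed.

Lemma birkhoff_upper (f : Om -> R) (e : R) :
  mu.-integrable setT (EFin \o f) -> 0 < e ->
  exists2 N : set Om, measurable N /\ mu N = 0%E &
    forall x, ~ N x -> exists C : nat, forall n,
      birkhoff_sum T f n x <= n%:R * (\int[mu]_x f x + e) + C%:R.
Proof.
move=> fi e0; set c := \int[mu]_x f x + e.
have ci : mu.-integrable setT (EFin \o (fun=> c)).
  exact: (@bounded_integrable _ _ _ _ _ `|c|).
have [||N [mN N0] hN] := @birkhoff_sum_ae_bounded (fun x => f x - c).
- exact: (integrableB measurableT fi ci).
- rewrite RintegralB// [X in _ - X](_ : _ = c); last first.
    by rewrite /Rintegral integral_cst_prob.
  by rewrite /c opprD addNKr oppr_lt0.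
exists N => // x /hN[C hC]; exists C => n.
by have := hC n; rewrite birkhoff_sumBcst lerBlDr addrC.
Qed.

(** The one-sided bound is applied to [f] and to its opposite. The error [e * n + C], valid for
    every [n], replaces a limit statement: an integer [C] indexes an increasing sequence of sets, to
    which [exhaustion_small] applies. *)
Theorem birkhoff_ae (f : Om -> R) (e : R) :
  mu.-integrable setT (EFin \o f) -> 0 < e ->
  exists2 N : set Om, measurable N /\ mu N = 0%E &
    forall x, ~ N x -> exists C : nat, forall n,
      `|birkhoff_sum T f n x - n%:R * \int[mu]_x f x| <= e * n%:R + C%:R.
Proof.
move=> fi e0.
have [N1 [mN1 N10] h1] := birkhoff_upper fi e0.
have fNi : mu.-integrable setT (EFin \o (\- f)) by exact: (integrableN fi).
have [N2 [mN2 N20] h2] := birkhoff_upper fNi e0.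
exists (N1 `|` N2).
  by split; [exact: measurableU|rewrite measureU0].
move=> x /not_orP[/h1[C1 hC1] /h2[C2 hC2]]; exists (maxn C1 C2) => n.
have := hC1 n; have := hC2 n; rewrite birkhoff_sumN.
have -> : \int[mu]_x (\- f) x = - \int[mu]_x f x.
  transitivity (\int[mu]_x (-1 * f x)).
    by apply: eq_Rintegral => y _; rewrite mulN1r.
  by rewrite RintegralZl// mulN1r.
have : (C1%:R : R) <= (maxn C1 C2)%:R by rewrite ler_nat leq_maxl.
have : (C2%:R : R) <= (maxn C1 C2)%:R by rewrite ler_nat leq_maxr.
move=> H1 H2 H3 H4; rewrite ler_norml; apply/andP; split; lra.
Qed.

End Birkhoff.

(** * Asymptotically invariant functions *)

(** Error budgets are divided by [M + 1] instead of [M] to allow [M = 0]. *)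
Lemma mulr_div_add1_le (R : realFieldType) (M e k : R) :
  0 <= M -> 0 <= e -> 0 < k -> M * (e / (k * (M + 1))) <= e / k.
Proof.
move=> M0 e0 k0; have M1 : 0 < M + 1 by rewrite ltr_wpDl.
rewrite (_ : M * _ = e / k * (M / (M + 1))); last first.
  by field; rewrite !gt_eqF.
by rewrite ler_piMr ?divr_ge0 ?(ltW k0)// ler_pdivrMr// mul1r lerDl.
Qed.

(** * Uniform Birkhoff bounds and the mean ergodic theorem *)

Section BirkhoffSet.
Context d (Om : measurableType d) (R : realType) (mu : probability Om R).
Variable T : Om -> Om.
Hypotheses (hT : measure_preserving mu T) (herg : ergodic mu T).

Definition birkhoff_set (f : Om -> R) (e : R) (C : nat) : set Om :=
  \bigcap_n [set x | `|birkhoff_sum T f n x - n%:R * \int[mu]_x f x| <= e * n%:R + C%:R].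

Lemma measurable_birkhoff_set f e C :
  measurable_fun setT f -> measurable (birkhoff_set f e C).
Proof.
move=> mf; apply: bigcap_measurableType => n _.
rewrite -[X in measurable X]setTI; apply: measurable_fun_ler => //.
apply: measurableT_comp => //; apply: measurable_funB => //.
exact: (measurable_birkhoff_sum hT).
Qed.

Lemma birkhoff_set_nd f e : {homo birkhoff_set f e : n m / (n <= m)%N >-> n `<=` m}.
Proof.
move=> n m nm x hx k _; apply: (le_trans (hx k Logic.I)).
by rewrite lerD2l ler_nat.
Qed.

Lemma birkhoff_set_ae f e : mu.-integrable setT (EFin \o f) -> 0 < e ->
  exists2 N : set Om, measurable N /\ mu N = 0%E &
    forall x, ~ N x -> exists C : nat, birkhoff_set f e C x.
Proof.
move=> fi e0; have [N mN hN] := birkhoff_ae hT herg fi e0.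
by exists N => // x /hN[C hC]; exists C => n _; exact: hC.
Qed.

(** Off a small set one constant [C] serves in Birkhoff's bound, and dividing by a large [m] makes
    it negligible; on the small set the bound on [u] is enough. *)
Lemma mean_ergodic_bounded (u : Om -> R) (B e : R) : measurable_fun setT u ->
  (forall x, `|u x| <= B) -> 0 < e -> exists2 m : nat, (0 < m)%N &
    \int[mu]_x `|birkhoff_sum T u m x / m%:R - \int[mu]_x u x| < e.
Proof.
move=> mu_ uB e0.
have ui : mu.-integrable setT (EFin \o u) by exact: bounded_integrable uB.
have B0 : 0 <= B by rewrite (le_trans _ (uB point)).
have e4 : 0 < e / 4 by rewrite divr_gt0.
have [N [mN N0] hN] := birkhoff_set_ae ui e4.
(* The average differs from the mean by at most [2 * B], so [Rintegral_close] charges [4 * B] times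
   the measure of the exceptional set. *)
have eB : 0 < e / 4 / (4 * B + 1) by rewrite divr_gt0// ltr_wpDl// mulr_ge0.
have [C hC] := exhaustion_small (fun C => measurable_birkhoff_set (e / 4) C mu_)
  mN N0 (@birkhoff_set_nd u (e / 4)) hN eB.
(* With this [m], the constant [C] is at most [e / 4 * m], and the total deviation of the average is
   at most [e / 2]. *)
pose m := (Num.truncn (C%:R / (e / 4))).+1.
have m0 : 0 < m%:R :> R by rewrite ltr0n.
exists m => //; set c := \int[mu]_x u x.
pose f x : R := `|birkhoff_sum T u m x / m%:R - c|.
have cB : `|c| <= B by exact: Rintegral_abs_le.
have SB x : `|birkhoff_sum T u m x| <= m%:R * B.
  apply: (le_trans (ler_norm_sum _ _ _)).
  by rewrite (le_trans (ler_sum _ (fun i _ => uB _)))// sumr_const card_ord mulr_natl.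
have fM x : `|f x| <= 2 * B.
  rewrite /f normr_id (le_trans (ler_normB _ _))// mulr2n mulrDl !mul1r lerD//.
  by rewrite normrM normfV (ger0_norm (ltW m0)) ler_pdivrMr// mulrC.
have := @Rintegral_close _ _ _ mu f (fun=> 0) (2 * B) (e / 2) _
  (measurableC (measurable_birkhoff_set (e / 4) C mu_)).
rewrite [X in _ - X](_ : _ = 0); last by rewrite /Rintegral integral0.
rewrite subr0 => h; apply: (le_lt_trans (ler_norm _)); apply: (le_lt_trans (h _ _ _ _ _)) => //.
- by rewrite divr_ge0// ltW.
- by move=> x; rewrite normr0 mulr_ge0.
- move=> x; rewrite subr0 /f normr_id => /contrapT /(_ m Logic.I) /= hx.
  rewrite -[c](mulfK (lt0r_neq0 m0)) -mulrBl normrM normfV (ger0_norm (ltW m0)).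
  rewrite ler_pdivrMr// (mulrC c) (le_trans hx)//.
  have : C%:R <= e / 4 * m%:R.
    by rewrite -ler_pdivrMl// mulrC ltW// truncnS_gt.
  by clear hC hx h => ?; lra.
have B1 : 0 < 4 * B + 1 by rewrite ltr_wpDl// mulr_ge0.
have p0 : 0 <= fine (mu (~` birkhoff_set u (e / 4) C)) by rewrite fine_ge0.
move: hC p0; rewrite ltr_pdivlMr//; move: (fine _) => p {h}; lra.
Qed.

End BirkhoffSet.

(** * Decorrelation of almost invariant functions from a fixed integrable one *)

Section AsymptoticInvariance.
Context d (Om : measurableType d) (R : realType) (mu : probability Om R).
Variable T : Om -> Om.
Hypotheses (hT : measure_preserving mu T) (herg : ergodic mu T).

Lemma bounded_mul_integrable (g u : Om -> R) (M : R) : measurable_fun setT g ->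
  (forall x, `|g x| <= M) -> mu.-integrable setT (EFin \o u) ->
  mu.-integrable setT (EFin \o (fun x => g x * u x)).
Proof.
move=> mg gM ui; rewrite (_ : EFin \o _ = (fun x => (g x)%:E * (u x)%:E)%E)//.
apply: integrableMr => //; exists M; split; first exact: num_real.
by move=> x Mx y _; exact: le_trans (gM y) (ltW Mx).
Qed.

Lemma Rintegral_mul_le (g u : Om -> R) (M : R) : measurable_fun setT g ->
  (forall x, `|g x| <= M) -> mu.-integrable setT (EFin \o u) ->
  `|\int[mu]_x (g x * u x)| <= M * \int[mu]_x `|u x|.
Proof.
move=> mg gM ui; have gui := bounded_mul_integrable mg gM ui.
apply: (le_trans (le_normr_Rintegral measurableT gui)).
rewrite -RintegralZl//; last exact: (integrable_norm ui).
apply: le_Rintegral => //; first exact: (integrable_norm gui).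
  exact: (integrableZl measurableT M (integrable_norm ui)).
by move=> x _; rewrite normrM ler_wpM2r.
Qed.

(* The coboundary [u - u \o T] is almost orthogonal to an almost invariant [g],
   because [\int g u = \int (g \o T) (u \o T)]. *)
Lemma coboundary_small (g u : Om -> R) (M B : R) :
  measurable_fun setT g -> (forall x, `|g x| <= M) ->
  measurable_fun setT u -> (forall x, `|u x| <= B) ->
  `|\int[mu]_x (g x * u x) - \int[mu]_x (g x * u (T x))|
  <= B * \int[mu]_x `|g (T x) - g x|.
Proof.
move=> mg gM mu_ uB.
have mgT : measurable_fun setT (g \o T) by apply: measurableT_comp mg _; exact: hT.1.
have muT : measurable_fun setT (u \o T) by apply: measurableT_comp mu_ _; exact: hT.1.
have gTi : mu.-integrable setT (EFin \o (g \o T)).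
  by apply: (@bounded_integrable _ _ _ _ _ M) => // x; exact: gM.
have gi : mu.-integrable setT (EFin \o g) by exact: bounded_integrable gM.
rewrite -(Rintegral_measure_preserving hT (f := fun x => g x * u x)); last first.
  exact: measurable_funM.
have uTi : mu.-integrable setT (EFin \o (u \o T)).
  by apply: (@bounded_integrable _ _ _ _ _ B) => // x; exact: uB.
rewrite -RintegralB//; last 2 first.
- exact: (bounded_mul_integrable mgT (fun x => gM (T x)) uTi).
- exact: (bounded_mul_integrable mg gM uTi).
under eq_Rintegral do rewrite -mulrBl mulrC.
apply: (@Rintegral_mul_le (u \o T) _ B) => //.
  by move=> x; exact: uB.
exact: (integrableB measurableT gTi gi).
Qed.

(** Replacing [u] by [u \o iter i T] takes [i] coboundary steps, hence costs at most [i * B] times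
    the invariance defect of [g]; summing over [i < m] gives the factor [m * m]. *)
Lemma birkhoff_sum_duality (g u : Om -> R) (M B : R) m :
  measurable_fun setT g -> (forall x, `|g x| <= M) ->
  measurable_fun setT u -> (forall x, `|u x| <= B) ->
  `|m%:R * \int[mu]_x (g x * u x) - \int[mu]_x (g x * birkhoff_sum T u m x)|
  <= m%:R * m%:R * B * \int[mu]_x `|g (T x) - g x|.
Proof.
move=> mg gM mu_ uB; set D := \int[mu]_x `|_|.
have D0 : 0 <= D by exact: Rintegral_ge0.
have B0 : 0 <= B by rewrite (le_trans _ (uB point)).
have mui i : measurable_fun setT (u \o iter i T).
  by apply: measurableT_comp mu_ _; exact: measurable_iter hT _.
have iui i : mu.-integrable setT (EFin \o (u \o iter i T)).
  by apply: (@bounded_integrable _ _ _ _ _ B) => // x; exact: uB.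
have giu i := bounded_mul_integrable mg gM (iui i).
have step i : `|\int[mu]_x (g x * u x) - \int[mu]_x (g x * u (iter i T x))| <= i%:R * B * D.
  elim: i => [|i ih]; first by rewrite subrr normr0 !mul0r.
  have := coboundary_small mg gM (mui i) (fun x => uB _).
  under [X in `|_ - X|]eq_Rintegral do rewrite /= -iterSr.
  rewrite -/D => h.
  rewrite -[X in `|X|](subrKA (\int[mu]_x (g x * u (iter i T x)))).
  rewrite (le_trans (ler_normD _ _))// -natr1 mulrDl mulrDl mul1r lerD//.
have SE k : \int[mu]_x (g x * birkhoff_sum T u k x) =
    \sum_(i < k) \int[mu]_x (g x * u (iter i T x)).
  elim: k => [|k ih].
    rewrite big_ord0 /Rintegral (_ : (fun=> _) = cst 0%E) ?integral0//.
    by apply/funext => x; rewrite /birkhoff_sum big_ord0 mulr0.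
  rewrite big_ord_recr/= -ih -RintegralD//.
    by apply: eq_Rintegral => x _; rewrite -mulrDr /birkhoff_sum big_ord_recr.
    apply: (bounded_mul_integrable mg gM).
    apply: (@bounded_integrable _ _ _ _ _ (k%:R * B)).
      exact: (measurable_birkhoff_sum hT).
    move=> x; apply: (le_trans (ler_norm_sum _ _ _)).
    by rewrite (le_trans (ler_sum _ (fun i _ => uB _)))// sumr_const card_ord mulr_natl.
  exact: (giu k).
rewrite SE -[X in X * _](_ : \sum_(i < m) 1 = m%:R); last by rewrite sumr_const card_ord.
rewrite mulr_suml -sumrB; apply: (le_trans (ler_norm_sum _ _ _)).
rewrite -!mulrA mulr_natl -[in leRHS](card_ord m) -sumr_const; apply: ler_sum => i _.
rewrite mul1r (le_trans (step i))// mulrA ler_wpM2r// ler_wpM2r// ler_nat ltnW//.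
by rewrite card_ord.
Qed.

(** Integrated against [g], the function [u] can be traded for its ergodic average of length [m],
    which is close to a constant in L1. The length [m] depends on [u], [M] and [e] alone, and [dl]
    is then taken small against [m], so it is uniform in [g]. *)
Lemma decorrelation_bounded (u : Om -> R) (B M e : R) :
  measurable_fun setT u -> (forall x, `|u x| <= B) -> 0 < e ->
  exists2 dl, 0 < dl & forall g : Om -> R, measurable_fun setT g ->
    (forall x, `|g x| <= M) -> \int[mu]_x `|g (T x) - g x| <= dl ->
    `|\int[mu]_x (g x * u x) - \int[mu]_x g x * \int[mu]_x u x| <= e.
Proof.
move=> mu_ uB e0; set c := \int[mu]_x u x.
have M1 : 0 < `|M| + 1 by rewrite ltr_wpDl.
have B0 : 0 <= B by rewrite (le_trans _ (uB point)).
have [m m0 hm] := mean_ergodic_bounded hT herg mu_ uB (divr_gt0 e0 (mulr_gt0 (ltr0Sn R 1) M1)).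
have m0' : 0 < m%:R :> R by rewrite ltr0n.
have B1 : 0 < B + 1 by rewrite ltr_wpDl.
exists (e / (2 * (m%:R * (B + 1)))); first by rewrite divr_gt0// mulr_gt0// mulr_gt0.
move=> g mg gM gT.
have M0 : 0 <= M by rewrite (le_trans _ (gM point)).
rewrite (ger0_norm M0) in M1 hm.
have h1 := birkhoff_sum_duality m mg gM mu_ uB.
have ui : mu.-integrable setT (EFin \o u) by exact: bounded_integrable uB.
have gi : mu.-integrable setT (EFin \o g) by exact: bounded_integrable gM.
have mS := measurable_birkhoff_sum hT m mu_.
have Si : mu.-integrable setT (EFin \o (birkhoff_sum T u m)).
  apply: (@bounded_integrable _ _ _ _ _ (m%:R * B)) => // x.
  apply: (le_trans (ler_norm_sum _ _ _)).
  by rewrite (le_trans (ler_sum _ (fun i _ => uB _)))// sumr_const card_ord mulr_natl.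
have gSi := bounded_mul_integrable mg gM Si.
have ci : mu.-integrable setT (EFin \o (fun=> c)).
  exact: (@bounded_integrable _ _ _ _ _ `|c|).
have Smi : mu.-integrable setT (EFin \o (fun x => birkhoff_sum T u m x / m%:R)).
  rewrite (_ : EFin \o _ = (fun x => (m%:R^-1)%:E * (birkhoff_sum T u m x)%:E)%E).
    exact: integrableZl.
  by apply/funext => x /=; rewrite -EFinM mulrC.
have Smci : mu.-integrable setT (EFin \o (fun x => birkhoff_sum T u m x / m%:R - c)).
  exact: (integrableB measurableT Smi ci).
have h2 := Rintegral_mul_le mg gM Smci.
have E2 : \int[mu]_x (g x * (birkhoff_sum T u m x / m%:R - c)) =
   m%:R^-1 * \int[mu]_x (g x * birkhoff_sum T u m x) - \int[mu]_x g x * c.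
  rewrite -RintegralZl// [X in _ - X]mulrC -RintegralZl// -RintegralB//.
  - by apply: eq_Rintegral => x _; ring.
  - exact: (integrableZl measurableT _ gSi).
  - exact: (integrableZl measurableT c gi).
rewrite E2 in h2; clear E2.
move: h1 h2 hm gT; set D := \int[mu]_x `|g _ - _|.
set X := \int[mu]_x (g x * u x); set Y := \int[mu]_x (g x * birkhoff_sum _ _ _ _).
set Z := \int[mu]_x g x; set W := \int[mu]_x `|_ - c| => h1 h2 hm gT.
have {}h1 : `|X - m%:R^-1 * Y| <= e / 2.
  rewrite -(ler_pM2l m0') -[in leLHS](ger0_norm (ltW m0')) -normrM mulrBr.
  rewrite (ger0_norm (ltW m0')) mulVKf ?gt_eqF// (le_trans h1)//.
  have : m%:R * (B + 1) * D <= e / 2.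
    by rewrite mulrC -ler_pdivlMr ?mulr_gt0// -mulrA -invfM.
  have D0 : 0 <= D by exact: Rintegral_ge0.
  move=> hD; rewrite -!mulrA ler_wpM2l ?(ltW m0')//; apply: le_trans hD.
  by rewrite -mulrA ler_wpM2l ?(ltW m0')// ler_wpM2r// lerDl.
have {}h2 : `|m%:R^-1 * Y - Z * c| <= e / 2.
  apply: (le_trans h2); apply: (le_trans (ler_wpM2l M0 (ltW hm))).
  by apply: mulr_div_add1_le => //; exact: ltW.
rewrite -[X in `|X|](subrKA (m%:R^-1 * Y)) (le_trans (ler_normD _ _))//.
by rewrite [leRHS]splitr lerD.
Qed.

Lemma truncation_small (u : Om -> R) (e : R) :
  mu.-integrable setT (EFin \o u) -> 0 < e -> exists (v : Om -> R) (B : R),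
  [/\ measurable_fun setT v, (forall x, `|v x| <= B) &
      \int[mu]_x `|u x - v x| < e].
Proof.
move=> ui e0; have mu_ : measurable_fun setT u by apply/measurable_EFinP; case/integrableP: ui.
pose v (k : nat) x := if `|u x| <= k%:R then u x else 0.
have mv k : measurable_fun setT (v k).
  apply: measurable_fun_ifT => //.
  by apply: measurable_fun_ler => //; exact: measurableT_comp.
have [] := @dominated_convergence _ _ _ mu setT measurableT
    (fun k => EFin \o v k) (EFin \o u) (EFin \o (fun x => `|u x|)).
- by move=> k; exact/measurable_EFinP.
- exact/measurable_EFinP.
- apply: nearW => x _; apply: cvg_near_cst.
  exists (Num.truncn `|u x|).+1 => // k /= hk; rewrite /v ifT//.
  by rewrite (le_trans (ltW (truncnS_gt _)))// ler_nat.
- exact: (integrable_norm ui).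
- apply: nearW => x k _ /=; rewrite lee_fin /v; case: ifP => // _.
  by rewrite normr0.
move=> _ /fine_cvgP[_ /cvgrPdist_lt /(_ _ e0)[k _ /(_ k (leqnn k))]] /= h _.
exists (v k), k%:R; split => //.
  by move=> x; rewrite /v; case: ifP => //; rewrite normr0.
move: h; rewrite sub0r normrN => h; apply: le_lt_trans h.
rewrite (le_trans _ (ler_norm _))// le_eqVlt; apply/orP; left; apply/eqP.
by rewrite /Rintegral; congr fine; apply: eq_integral => x _ /=; rewrite distrC.
Qed.

(** Truncation reduces to the bounded case. The truncation error enters twice, in the integral of
    [g * u] and in the mean of [u], each time within [e / 4]; the bounded case takes the remaining
    [e / 2]. *)
Lemma decorrelation (u : Om -> R) (M e : R) :
  mu.-integrable setT (EFin \o u) -> 0 < e ->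
  exists2 dl, 0 < dl & forall g : Om -> R, measurable_fun setT g ->
    (forall x, `|g x| <= M) -> \int[mu]_x `|g (T x) - g x| <= dl ->
    `|\int[mu]_x (g x * u x) - \int[mu]_x g x * \int[mu]_x u x| <= e.
Proof.
move=> ui e0.
have M1 : 0 < `|M| + 1 by rewrite ltr_wpDl.
have [v [B [mv vB uv]]] := truncation_small ui (divr_gt0 e0 (mulr_gt0 (ltr0Sn R 3) M1)).
have [dl dl0 h] := decorrelation_bounded M mv vB (divr_gt0 e0 (ltr0Sn R 1)).
exists dl => // g mg gM gT; have {h}h := h g mg gM gT.
have M0 : 0 <= M by rewrite (le_trans _ (gM point)).
rewrite (ger0_norm M0) in M1 uv.
have vi : mu.-integrable setT (EFin \o v) by exact: bounded_integrable vB.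
have uvi : mu.-integrable setT (EFin \o (fun x => u x - v x)).
  exact: (integrableB measurableT ui vi).
have h1 := Rintegral_mul_le mg gM uvi.
have E1 : \int[mu]_x (g x * (u x - v x)) = \int[mu]_x (g x * u x) - \int[mu]_x (g x * v x).
  rewrite -RintegralB//; last 2 first.
  - exact: bounded_mul_integrable gM ui.
  - exact: bounded_mul_integrable gM vi.
  by apply: eq_Rintegral => x _; rewrite mulrBr.
have h2 : `|\int[mu]_x u x - \int[mu]_x v x| <= \int[mu]_x `|u x - v x|.
  by rewrite -RintegralB//; exact: le_normr_Rintegral.
have h3 : `|\int[mu]_x g x| <= M by exact: Rintegral_abs_le.
rewrite E1 in h1; clear E1.
move: h h1 h2 h3 uv; set X := \int[mu]_x (g x * u x); set Y := \int[mu]_x (g x * v x).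
set Z := \int[mu]_x g x; set U := \int[mu]_x u x; set V := \int[mu]_x v x.
set W := \int[mu]_x `|_ - _| => h h1 h2 h3 uv.
have MW : M * W <= e / 4.
  apply: (le_trans (ler_wpM2l M0 (ltW uv))).
  by apply: mulr_div_add1_le => //; exact: ltW.
have h4 : `|Z * V - Z * U| <= e / 4.
  rewrite -mulrBr normrM distrC (le_trans _ MW)//.
  by rewrite ler_pM.
rewrite (_ : X - Z * U = (X - Y) + (Y - Z * V) + (Z * V - Z * U)); last by ring.
rewrite (le_trans (ler_normD _ _))// (_ : e = e / 4 + e / 2 + e / 4); last by field.
by rewrite lerD// (le_trans (ler_normD _ _))// lerD// (le_trans h1).
Qed.

(** This is decorrelation from the density of [nu], whose mean under [mu] is 1. *)
Theorem abs_cont_almost_invariant (nu : probability Om R) (M e : R) :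
  nu `<< mu -> 0 < e ->
  exists2 dl, 0 < dl & forall g : Om -> R, measurable_fun setT g ->
    (forall x, `|g x| <= M) -> \int[mu]_x `|g (T x) - g x| <= dl ->
    `|\int[nu]_x g x - \int[mu]_x g x| <= e.
Proof.
move=> numu e0; have [u [ui uE uA]] := density_exists numu.
have [dl dl0 h] := decorrelation M ui e0.
exists dl => // g mg gM gT; have := h g mg gM gT.
rewrite (uE g M)// -(uA setT)// (_ : nu setT = 1%E) ?mulr1//.
exact: probability_setT.
Qed.

End AsymptoticInvariance.

(** * Integrals against point measures and the vague topology *)

Section PointMeasureIntegral.
Context (E : ptopologicalType) (R : realType).
Implicit Types (N : point_measure E R) (f g : test_function E R).

Lemma continuous_borel_measurable (f : E -> R) :
  continuous f -> measurable_fun setT (f : borel E -> R).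
Proof.
move=> /continuousP cf; apply: (measurability _ (RGenOInfty.measurableE R)).
move=> _ [_ [x -> <-]]; rewrite setTI; apply: sub_sigma_algebra.
exact/cf/interval_open.
Qed.

Lemma closed_borel_measurable (K : set E) : closed K -> measurable (K : set (borel E)).
Proof.
move=> cK; rewrite -(setCK K); apply: measurableC; apply: sub_sigma_algebra.
exact: closed_openC.
Qed.

(** Padding with the zero measure off [D] makes the sum a series of measures over all of [nat], so
    that countable additivity comes with [mseries]. *)
Definition dirac_or_zero (D : set nat) (z : nat -> borel E) (k : nat) :
    {measure set (borel E) -> \bar R} :=
  if k \in D then (\d_(z k) : {measure set (borel E) -> \bar R})
  else (mzero : {measure set (borel E) -> \bar R}).

Lemma mseries_dirac (D : set nat) (z : nat -> borel E) (B : set (borel E)) :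
  mseries (dirac_or_zero D z) 0 B = (\esum_(i in D) \d_(z i) B)%E.
Proof.
rewrite /mseries nneseries_esumT// [RHS]esum_mkcond; apply: eq_esum => i _.
by rewrite /dirac_or_zero; case: ifP.
Qed.

Lemma pm_measure_exists N : exists m : {measure set (borel E) -> \bar R},
  (m : set (borel E) -> \bar R) = N.
Proof.
have [[D [z NE]] _] := pm_prop N; exists (mseries (dirac_or_zero D z) 0).
by apply/funext => B; rewrite NE; exact: mseries_dirac.
Qed.

Lemma test_function_bounded f : exists2 M, 0 <= M & forall z, `|f z| <= M.
Proof.
have cf : compact [set f x | x in closure [set z | f z != 0]].
  apply: continuous_compact; last exact: test_compact.
  by apply: continuous_subspaceT; exact: test_continuous.
have [M [_ hM]] := compact_bounded cf.
exists (`|M| + 1) => [|z]; first by rewrite addr_ge0.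
have [->|fz] := eqVneq (f z) 0; first by rewrite normr0 addr_ge0.
apply: hM; first by rewrite (le_lt_trans (ler_norm _))// ltrDl.
by exists z => //; apply: subset_closure.
Qed.

Lemma test_integrable (m : {measure set (borel E) -> \bar R}) N f :
  (m : set (borel E) -> \bar R) = N -> m.-integrable setT (EFin \o f).
Proof.
move=> mN; pose K : set (borel E) := closure [set z | f z != 0].
have mK : measurable K by apply: closed_borel_measurable; exact: closed_closure.
have -> : EFin \o f = (EFin \o f) \_ K.
  apply/funext => z; rewrite patchE; case: ifPn => // /negP zK /=; congr EFin.
  apply/eqP/negPn/negP => fz; apply: zK; rewrite inE.
  exact: subset_closure.
apply/(integrable_mkcond (EFin \o f : borel E -> \bar R) mK); apply: measurable_bounded_integrable => //.
- by rewrite mN; apply: (pm_prop N).2; exact: test_compact.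
- apply: measurable_funTS; apply: continuous_borel_measurable.
  exact: test_continuous.
- have [M _ hM] := test_function_bounded f.
  exists M; split; first exact: num_real.
  by move=> x Mx y _; exact: le_trans (hM y) (ltW Mx).
Qed.

Lemma pm_integral_Rintegral (m : {measure set (borel E) -> \bar R}) N f :
  (m : set (borel E) -> \bar R) = N -> pm_integral N f = \int[m]_z f z.
Proof. by move=> mN; rewrite /pm_integral -mN. Qed.

Lemma ge0_pm_integral N (D : set nat) (z : nat -> borel E) f :
  (forall B, N B = (\esum_(i in D) \d_(z i) B)%E) -> (forall y, 0 <= f y) ->
  (pm_integral N f)%:E = (\esum_(i in D) (f (z i))%:E)%E.
Proof.
move=> NE f0; have mN : (mseries (dirac_or_zero D z) 0 : set (borel E) -> \bar R) = N.
  by apply/funext => B; rewrite NE; exact: mseries_dirac.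
have fi := test_integrable f mN.
rewrite (pm_integral_Rintegral f mN) /Rintegral fineK; last exact: integrable_fin_num.
have mf : measurable_fun setT (EFin \o f : borel E -> \bar R).
  by case/integrableP: fi.
rewrite ge0_integral_measure_series//; last by move=> y _; rewrite lee_fin.
rewrite nneseries_esumT; last first.
  by move=> n; apply: integral_ge0 => y _; rewrite lee_fin.
rewrite [RHS]esum_mkcond; apply: eq_esum => i _; rewrite /dirac_or_zero.
case: ifP => _; last exact: integral_measure_zero.
by rewrite integral_dirac// diracT mul1e.
Qed.

Lemma le_pm_integral N f g : (forall z, f z <= g z) ->
  pm_integral N f <= pm_integral N g.
Proof.
move=> fg; have [m mN] := pm_measure_exists N.
rewrite !(pm_integral_Rintegral _ mN); apply: le_Rintegral => //.
- exact: test_integrable mN.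
- exact: test_integrable mN.
Qed.

Lemma pm_integralB N f g (h : test_function E R) : (forall z, h z = f z - g z) ->
  pm_integral N h = pm_integral N f - pm_integral N g.
Proof.
move=> hE; have [m mN] := pm_measure_exists N.
rewrite !(pm_integral_Rintegral _ mN) -RintegralB//.
- by apply: eq_Rintegral => z _; exact: hE.
- exact: test_integrable mN.
- exact: test_integrable mN.
Qed.

Lemma pm_integralZ N f (h : test_function E R) (c : R) : (forall z, h z = c * f z) ->
  pm_integral N h = c * pm_integral N f.
Proof.
move=> hE; have [m mN] := pm_measure_exists N.
rewrite !(pm_integral_Rintegral _ mN) -RintegralZl//.
- by apply: eq_Rintegral => z _; exact: hE.
- exact: test_integrable mN.
Qed.

Lemma test_function_exists (f : E -> R) (K : set E) : continuous f ->
  closed K -> compact K -> (forall z, ~ K z -> f z = 0) ->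
  exists g : test_function E R, g = f :> (E -> R).
Proof.
move=> cf clK cK fK.
have hK : compact (closure [set z | f z != 0]).
  apply: (subclosed_compact _ cK); first exact: closed_closure.
  apply: (subset_trans (closureS _) _ (B := closure K)); last first.
    by rewrite -(proj1 (closure_id _) clK).
  by move=> z /= /negP fz; apply: contrapT => /fK /eqP.
by exists (TestFunction cf hK).
Qed.

Lemma pm_integral_continuous f : continuous (fun N => pm_integral N f).
Proof.
move=> N.
have h1 := @initial_continuous _ _
  (@pm_integral E R : _ -> {ptws test_function E R -> R}) N.
have h2 := @proj_continuous _ (fun _ : test_function E R => R : topologicalType)
  f (pm_integral N).
exact: (cvg_comp _ _ h1 h2).
Qed.

(** The filter is arbitrary because it will be generated by pseudo-distance balls in
    [envelope_cvg]. *)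
Lemma cvg_vague (F : set_system (point_measure E R)) N0 : Filter F ->
  (forall f, pm_integral N f @[N --> F] --> pm_integral N0 f) -> F --> N0.
Proof.
move=> FF h.
have h' : (@pm_integral E R @ F : set_system {ptws test_function E R -> R}) -->
    (pm_integral N0 : {ptws test_function E R -> R}).
  apply/cvg_sup => i.
  rewrite cvg_image; last by rewrite eqEsubset; split=> v // _; exists (cst v).
  move=> W /= /(h i) Q; exists (@^~ i @^-1` W) => //.
  by rewrite eqEsubset; split => [j [? + <-//]|j Wj]; exists (fun _ => j).
move=> A [_ [[B oB <-] BN0] BA].
have /h' : nbhs (pm_integral N0 : {ptws test_function E R -> R}) B by exact: open_nbhs_nbhs.
by move=> FB; exact: filterS BA FB.
Qed.

End PointMeasureIntegral.

(** * Countable families of test functions that determine vague convergence *)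

Section DeterminingFamily.
Context (E : ptopologicalType) (R : realType).
Implicit Types (N : point_measure E R) (f g : test_function E R).

(** The second clause asks for approximation from below at finitely many points only, because all
    but a small part of an integral against a point measure is carried by finitely many atoms. The
    third supplies an upper bound whose integrals converge, which turns lower semicontinuity into
    continuity. *)
Definition determining (c : nat -> test_function E R) :=
  [/\ forall j z, 0 <= c j z,
      forall f (s : seq E) (e : R), (forall z, 0 <= f z) -> 0 < e ->
        exists2 j, (forall z, c j z <= f z) & (forall z, z \in s -> f z - e <= c j z) &
      forall f, exists j (k : nat), forall z, f z <= k%:R * c j z].

Variable c : nat -> test_function E R.
Hypothesis cD : determining c.

Lemma sum_le_add_cst (I : eqType) (s : seq I) (a b : I -> R) (e : R) :
  (forall i, i \in s -> a i - e <= b i) ->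
  \sum_(i <- s) a i <= \sum_(i <- s) b i + (size s)%:R * e.
Proof.
elim: s => [|x s ih] h; first by rewrite !big_nil mul0r addr0.
rewrite !big_cons -[(size _)%:R]/((size s).+1%:R) -natr1 mulrDl mul1r.
have h1 := h x (mem_head _ _).
have h2 : \sum_(i <- s) a i <= \sum_(i <- s) b i + (size s)%:R * e.
  by apply: ih => i si; apply: h; rewrite inE si orbT.
by lra.
Qed.

(** Finitely many atoms of [N0] nearly exhaust the integral of [f]. Some [c j] below [f] is close to
    [f] at these atoms; its integral converges and bounds that of [f] from below along the
    filter. *)
Lemma determining_lsc (F : set_system (point_measure E R)) N0 f : Filter F ->
  (forall z, 0 <= f z) ->
  (forall j, pm_integral N (c j) @[N --> F] --> pm_integral N0 (c j)) ->
  forall e, 0 < e -> \forall N \near F, pm_integral N0 f - e <= pm_integral N f.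
Proof.
move=> FF f0 cF e e0; have [c0 cf _] := cD.
have e2 : 0 < e / 2 by rewrite divr_gt0.
have e4 : 0 < e / 2 / 2 by rewrite divr_gt0.
have [[D [z NE]] _] := pm_prop N0.
have NE' B : N0 B = (\esum_(i in D) \d_(z i : borel E) B)%E by rewrite NE.
have fE := ge0_pm_integral NE' f0.
have [X XD Xf] : exists2 X, fsets D X &
    ((pm_integral N0 f - e / 2 / 2)%:E < \sum_(i \in X) (f (z i))%:E)%E.
  have : ((pm_integral N0 f - e / 2 / 2)%:E < \esum_(i in D) (f (z i))%:E)%E.
    by rewrite -fE lte_fin ltrBlDr ltrDl.
  by move=> /ereal_sup_gt[_ [X XD <-] h]; exists X.
have [finX XD'] := XD.
pose s := finmap.enum_fset (fset_set X); pose n := size s.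
have n1 : 0 < n%:R + 1 :> R by rewrite ltr_wpDl.
have en : 0 < e / 2 / 2 / (n%:R + 1) by rewrite divr_gt0.
have [j cjf cjz] := cf f [seq z i | i <- s] _ f0 en.
have h : pm_integral N0 f - e / 2 <= pm_integral N0 (c j).
  rewrite -lee_fin (ge0_pm_integral NE' (c0 j)).
  apply: (@le_trans _ _ (\sum_(i \in X) (c j (z i))%:E)%E); last first.
    by apply: ereal_sup_ubound; exists X.
  move: Xf; rewrite !fsbig_finite//= !sumEFin lte_fin lee_fin => Xf.
  have := @sum_le_add_cst _ s (f \o z) (c j \o z) _ (fun i iX => cjz _ (map_f z iX)).
  rewrite -/n => hs.
  have : n%:R * (e / 2 / 2 / (n%:R + 1)) <= e / 2 / 2.
    by have := @mulr_div_add1_le _ n%:R (e / 2 / 2) 1 (ler0n _ _) (ltW e4) ltr01;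
       rewrite mul1r divr1.
  by move: hs Xf; rewrite /comp; lra.
have cFj := cF j; near=> N.
apply: (@le_trans _ _ (pm_integral N (c j))); last exact: le_pm_integral.
have : `|pm_integral N0 (c j) - pm_integral N (c j)| < e / 2.
  by near: N; exact: cvgr_dist_lt cFj _ e2.
by rewrite ltr_norml => /andP[_]; lra.
Unshelve. all: by end_near. Qed.

Lemma determining_cvg (F : set_system (point_measure E R)) N0 : Filter F ->
  (forall j, pm_integral N (c j) @[N --> F] --> pm_integral N0 (c j)) -> F --> N0.
Proof.
move=> FF cF; apply: cvg_vague => f.
(* Positive and negative parts keep the support inside that of [f], so both are test functions. *)
wlog f0 : f / forall z, 0 <= f z.
  move=> h; pose K := closure [set z | f z != 0].
  have clK : closed K by exact: closed_closure.
  have cK : compact K by exact: test_compact.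
  have [fp fpE] : exists g : test_function E R, g = (fun z => Num.max (f z) 0) :> (E -> R).
    apply: test_function_exists clK cK _.
      move=> z; apply: continuous_max; [exact: test_continuous|exact: cst_continuous].
    by move=> z Kz; apply/eqP/negPn/negP => fz; apply: Kz; apply: subset_closure => /=;
       apply: contra fz => /eqP ->; rewrite maxxx.
  have [fn fnE] : exists g : test_function E R, g = (fun z => Num.max (- f z) 0) :> (E -> R).
    apply: test_function_exists clK cK _.
      have cNf : continuous (fun z => - f z).
        by move=> z; apply: continuousN; exact: test_continuous.
      by move=> z; exact: (continuous_max (cNf z) (@cst_continuous _ _ 0 z)).
    by move=> z Kz; apply/eqP/negPn/negP => fz; apply: Kz; apply: subset_closure => /=;
       apply: contra fz => /eqP ->; rewrite oppr0 maxxx.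
  have fE N : pm_integral N f = pm_integral N fp - pm_integral N fn.
    apply: pm_integralB => z; rewrite fpE fnE.
    by rewrite !maxElt; case: ltrP => h1; case: ltrP => h2; lra.
  under eq_fun do rewrite fE.
  rewrite fE; apply: cvgB; apply: h => z.
    by rewrite fpE le_max lexx orbT.
  by rewrite fnE le_max lexx orbT.
have [c0 _ /(_ f)[j [k fk]]] := cD.
have ckc : continuous (fun z => k%:R * c j z).
  by move=> z; apply: cvgM; [exact: cvg_cst|exact: test_continuous].
(* Lower semicontinuity for the nonnegative function [k * c j - f], together with convergence for
   [k * c j], is upper semicontinuity for [f]. *)
have [h hE] : exists h : test_function E R, h = (fun z => k%:R * c j z - f z) :> (E -> R).
  have clK : closed (closure [set z | c j z != 0]) by exact: closed_closure.
  apply: test_function_exists clK (@test_compact _ _ _) _.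
    move=> z; exact: (continuousB (ckc z) (@test_continuous _ _ f z)).
  move=> z Kz; have cz : c j z = 0.
    by apply/eqP/negPn/negP => cz; apply: Kz; exact: subset_closure.
  have := fk z; rewrite cz mulr0 sub0r => fz.
  by apply/eqP; rewrite oppr_eq0 eq_le fz f0.
have [kc kcE] : exists h : test_function E R, h = (fun z => k%:R * c j z) :> (E -> R).
  have clK : closed (closure [set z | c j z != 0]) by exact: closed_closure.
  apply: test_function_exists ckc clK (@test_compact _ _ _) _.
  move=> z Kz; have -> : c j z = 0; last by rewrite mulr0.
  by apply/eqP/negPn/negP => cz; apply: Kz; exact: subset_closure.
have hI N : pm_integral N h = k%:R * pm_integral N (c j) - pm_integral N f.
  rewrite -(@pm_integralZ _ _ N _ kc); last by move=> z; rewrite kcE.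
  by apply: pm_integralB => z; rewrite hE kcE.
have h0 z : 0 <= h z by rewrite hE subr_ge0.
have cFk : k%:R * pm_integral N (c j) @[N --> F] --> k%:R * pm_integral N0 (c j).
  by apply: cvgM; [exact: cvg_cst|exact: cF].
apply/cvgrPdist_le => e e0; have e2 : 0 < e / 2 by rewrite divr_gt0.
near=> N.
have h1 : pm_integral N0 f - e <= pm_integral N f by near: N; exact: determining_lsc.
have h2 : pm_integral N0 h - e / 2 <= pm_integral N h by near: N; exact: determining_lsc.
have h3 : `|k%:R * pm_integral N0 (c j) - k%:R * pm_integral N (c j)| < e / 2.
  by near: N; exact: cvgr_dist_lt cFk _ e2.
move: h1 h2 h3; rewrite !hI ltr_norml ler_norml => h1 h2 /andP[h3 h4].
by apply/andP; split; lra.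
Unshelve. all: by end_near. Qed.

End DeterminingFamily.

(** * Functionals of finitely many integrals *)

Section CountableRange.
Context d (Om : measurableType d) d' (U : measurableType d') (K : countType).

Lemma measurable_countable_range (g : Om -> K) (h : K -> U) :
  (forall k, measurable (g @^-1` [set k])) -> measurable_fun setT (h \o g).
Proof.
move=> mg _ Y mY; rewrite setTI.
rewrite (_ : _ @^-1` _ = \bigcup_(n in [set n : nat | exists2 k : K, unpickle n = Some k & Y (h k)])
    (if unpickle n is Some k then g @^-1` [set k] else set0)).
  by apply: bigcup_measurable => n _; case: unpickle.
apply/seteqP; split => [x Yx|x [n [k nk Yk]]]; last by rewrite nk /= => ->.
by exists (pickle (g x)) => /=; [exists (g x) => //|]; rewrite pickleK.
Qed.

End CountableRange.

(** * Lipschitz functionals of finitely many integrals, and envelopes *)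

Section CylinderFunctional.
Context (E : ptopologicalType) (R : realType) (c : nat -> test_function E R).
Implicit Types (N : point_measure E R) (F G : point_measure E R -> R).

Definition pm_dist k N N' :=
  \sum_(j < k) `|pm_integral N (c j) - pm_integral N' (c j)|.

Lemma pm_dist_ge0 k N N' : 0 <= pm_dist k N N'.
Proof. exact: sumr_ge0. Qed.

Lemma pm_distxx k N : pm_dist k N N = 0.
Proof. by rewrite /pm_dist big1// => i _; rewrite subrr normr0. Qed.

Lemma pm_dist_sym k N N' : pm_dist k N N' = pm_dist k N' N.
Proof. by apply: eq_bigr => i _; rewrite distrC. Qed.

Lemma pm_dist_triangle k N N' N'' : pm_dist k N N'' <= pm_dist k N N' + pm_dist k N' N''.
Proof. by rewrite /pm_dist -big_split/=; apply: ler_sum => i _; exact: ler_distD. Qed.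

Lemma pm_dist_mono k k' N N' : (k <= k')%N -> pm_dist k N N' <= pm_dist k' N N'.
Proof.
move=> kk'; rewrite /pm_dist (big_ord_widen k' (fun j =>
  `|pm_integral N (c j) - pm_integral N' (c j)|))// big_mkcond/=.
by apply: ler_sum => i _; case: ifP.
Qed.

Definition cylinder_lipschitz k (L : R) G :=
  forall N N', `|G N - G N'| <= L * pm_dist k N N'.

Lemma cylinder_lipschitz_cvg (F : set_system (point_measure E R)) k L G N :
  Filter F -> cylinder_lipschitz k L G ->
  (forall j, pm_integral N' (c j) @[N' --> F] --> pm_integral N (c j)) ->
  G N' @[N' --> F] --> G N.
Proof.
move=> FF GL cF; apply/cvgrPdist_le => e e0.
have dk : pm_dist k N N' @[N' --> F] --> 0.
  rewrite -(pm_distxx k N); elim: k {GL} => [|k ih].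
    under eq_fun do rewrite /pm_dist big_ord0.
    by rewrite /pm_dist big_ord0; exact: cvg_cst.
  under eq_fun do rewrite /pm_dist big_ord_recr; rewrite /pm_dist big_ord_recr/=.
  apply: cvgD; first exact: ih.
  by apply: cvg_norm; apply: cvgB; [exact: cvg_cst|exact: cF].
have L1 : 0 < `|L| + 1 by rewrite ltr_wpDl.
near=> N'; apply: (le_trans (GL _ _)).
have : `|0 - pm_dist k N N'| < e / (`|L| + 1).
  by near: N'; apply: cvgr_dist_lt dk _ _; rewrite divr_gt0.
rewrite sub0r normrN (ger0_norm (pm_dist_ge0 _ _ _)) ltr_pdivlMr// => h.
apply: le_trans (ltW h); rewrite [leRHS]mulrC ler_wpM2r ?pm_dist_ge0//.
by rewrite (le_trans (ler_norm _))// lerDl.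
Unshelve. all: by end_near. Qed.

Lemma cylinder_lipschitz_continuous k L G : cylinder_lipschitz k L G -> continuous G.
Proof.
move=> GL N; apply: (cylinder_lipschitz_cvg (nbhs_filter N) GL) => j.
exact: pm_integral_continuous.
Qed.

Section Measurability.
Context d (Om : measurableType d) (X : Om -> point_measure E R).
Hypothesis mX : forall j, measurable_fun setT (fun w => pm_integral (X w) (c j)).

(** [G] is given on point measures and not on [k]-tuples of reals, so the tuple of integrals is
    discretized: [key n] records the cell of a grid of mesh [1 / n.+1], and [rep n] picks a sample
    point in each cell that occurs. Evaluating at the sample point gives a function of a countable
    key, and the Lipschitz bound makes these functions converge. *)
Lemma measurable_cylinder_lipschitz k L G :
  cylinder_lipschitz k L G -> measurable_fun setT (G \o X).
Proof.
move=> GL.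
pose key n w : {ffun 'I_k -> int} :=
  [ffun j : 'I_k => Num.floor (n.+1%:R * pm_integral (X w) (c j))].
pose rep n (q : {ffun 'I_k -> int}) : Om := get [set w | key n w = q].
have keyrep n w : key n (rep n (key n w)) = key n w.
  by have /getPex : exists w', [set w' | key n w' = key n w] w' by exists w.
apply: (@measurable_fun_cvg _ _ _ _ (fun n => (G \o X \o rep n) \o key n)).
  move=> n; apply: measurable_countable_range => q.
  rewrite (_ : _ @^-1` _ = \bigcap_(j in [set: 'I_k])
      [set w | Num.floor (n.+1%:R * pm_integral (X w) (c j)) = q j]); last first.
    apply/seteqP; split => [w /= <- j _|w h] /=; first by rewrite ffunE.
    by apply/ffunP => j; rewrite ffunE h.
  apply: fin_bigcap_measurable => // j _.
  rewrite (_ : [set w | _] = [set w | (q j)%:~R <= n.+1%:R * pm_integral (X w) (c j)] `&`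
     [set w | n.+1%:R * pm_integral (X w) (c j) < (q j + 1)%:~R]); last first.
    apply/seteqP; split => [w /= <-|w /= [h1 h2]].
      by split; [exact: floor_le|exact: floorD1_gt].
    by apply/floor_def; rewrite h1.
  have mj : measurable_fun setT (fun w => n.+1%:R * pm_integral (X w) (c j)).
    by apply: measurable_funM => //; exact: mX.
  by apply: measurableI; rewrite -[X in measurable X]setTI;
    [apply: measurable_fun_ler|apply: measurable_fun_ltr].
move=> w _; apply/cvgrPdist_le => e e0.
have kL : 0 <= `|L| * k%:R by rewrite mulr_ge0.
exists (Num.truncn (`|L| * k%:R / e)).+1 => // n /= hn.
apply: (le_trans (GL _ _)).
apply: (@le_trans _ _ (`|L| * pm_dist k (X w) (X (rep n (key n w))))).
  by rewrite ler_wpM2r ?pm_dist_ge0// ler_norm.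
have n0 : 0 < n.+1%:R :> R by rewrite ltr0n.
have : pm_dist k (X w) (X (rep n (key n w))) <= k%:R * n.+1%:R^-1.
  rewrite /pm_dist mulr_natl -[k in leRHS]card_ord -sumr_const; apply: ler_sum => j _.
  have := keyrep n w => /ffunP/(_ j); rewrite !ffunE.
  set a := pm_integral (X w) _; set b := pm_integral _ _ => ab.
  have := floor_le (n.+1%:R * a); have := floorD1_gt (n.+1%:R * a).
  have := floor_le (n.+1%:R * b); have := floorD1_gt (n.+1%:R * b).
  rewrite ab intrD; set q := (_%:~R) => h1 h2 h3 h4.
  rewrite -(ler_pM2l n0) mulfV ?gt_eqF// -[X in X * _](ger0_norm (ltW n0)) -normrM mulrBr.
  rewrite ler_norml; apply/andP; split; clear -h1 h2 h3 h4; lra.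
move=> /(ler_wpM2l (normr_ge0 L)) /le_trans; apply.
rewrite mulrA ler_pdivrMr// [leRHS]mulrC -ler_pdivrMr//.
by rewrite (le_trans (ltW (truncnS_gt _)))// ler_nat leqW.
Qed.

End Measurability.

(* The inf-convolution of [F] with [k%:R * pm_dist k]: it is a function of the
   first [k] coordinates, and increases to [F] when [c] is determining. *)
Definition envelope F k N :=
  inf [set F N' + k%:R * pm_dist k N N' | N' in [set: point_measure E R]].

Section Envelope.
Variables (F : point_measure E R -> R) (M : R).
Hypothesis FM : forall N, `|F N| <= M.

Lemma envelope_lb k N :
  lbound [set F N' + k%:R * pm_dist k N N' | N' in [set: point_measure E R]] (- M).
Proof.
move=> _ [N' _ <-]; apply: ler_wpDr; first by rewrite mulr_ge0// pm_dist_ge0.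
by have := FM N'; rewrite ler_norml => /andP[].
Qed.

Lemma envelope_le_at k N N' : envelope F k N <= F N' + k%:R * pm_dist k N N'.
Proof. by apply: ge_inf; [exists (- M); exact: envelope_lb|exists N']. Qed.

Lemma envelope_le k N : envelope F k N <= F N.
Proof. by have := envelope_le_at k N N; rewrite pm_distxx mulr0 addr0. Qed.

Lemma envelope_glb k N a : (forall N', a <= F N' + k%:R * pm_dist k N N') ->
  a <= envelope F k N.
Proof.
move=> h; apply: lb_le_inf; first by exists (F N + k%:R * pm_dist k N N), N.
by move=> _ [N' _ <-].
Qed.

Lemma envelope_bounded k N : `|envelope F k N| <= M.
Proof.
rewrite ler_norml (le_trans (envelope_le _ _) (le_trans (ler_norm _) (FM _))) andbT.
by apply: lb_le_inf; [exists (F N + k%:R * pm_dist k N N), N|exact: envelope_lb].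
Qed.

Lemma envelope_lipschitz k : cylinder_lipschitz k k%:R (envelope F k).
Proof.
have h N N' : envelope F k N <= envelope F k N' + k%:R * pm_dist k N N'.
  rewrite -lerBlDr; apply: envelope_glb => N''; rewrite lerBlDr.
  apply: (le_trans (envelope_le_at k N N'')); rewrite -addrA lerD2l -mulrDr.
  by rewrite ler_wpM2l// addrC pm_dist_triangle.
move=> N N'; have := h N N'; have := h N' N; rewrite (pm_dist_sym k N' N) ler_norml.
by move=> h1 h2; apply/andP; split; clear -h1 h2; lra.
Qed.

(** Measures near [N] in the pseudo-distance have nearly the same value of [F], by continuity; for
    the others the penalty of the inf-convolution exceeds the oscillation of [F]. *)
Lemma envelope_cvg N : determining c -> continuous F ->
  envelope F k N @[k --> \oo] --> F N.
Proof.
move=> cD cF; apply/cvgrPdist_le => e e0.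
pose U k := [set N' | pm_dist k N N' < k.+1%:R^-1].
have FU : Filter (filter_from [set: nat] U).
  apply: filter_from_filter; first by exists 0%N.
  move=> i j _ _; exists (maxn i j) => // N' h; split; move: h; rewrite /U /=.
    move=> /(le_lt_trans (pm_dist_mono _ _ (leq_maxl i j))) /lt_le_trans; apply.
    by rewrite lef_pV2 ?posrE ?ltr0n// ler_nat ltnS leq_maxl.
  move=> /(le_lt_trans (pm_dist_mono _ _ (leq_maxr i j))) /lt_le_trans; apply.
  by rewrite lef_pV2 ?posrE ?ltr0n// ler_nat ltnS leq_maxr.
have UN : filter_from [set: nat] U --> N.
  apply: (determining_cvg cD) => j; apply/cvgrPdist_le => r r0.
  (* Beyond [j] the [j]-th integral enters [pm_dist k], and the radius [1 / k.+1] is at most [r]. *)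
  pose k := maxn j.+1 (Num.truncn r^-1).
  exists k => // N' /= UN'.
  have jk : (j < k)%N by rewrite /k leq_max ltnSn.
  apply: (@le_trans _ _ (pm_dist k N N')).
    by rewrite /pm_dist (bigD1 (Ordinal jk))//= lerDl sumr_ge0.
  apply: (le_trans (ltW UN')); rewrite -[leRHS]invrK lef_pV2 ?posrE ?ltr0n ?invr_gt0//.
  by rewrite (le_trans (ltW (truncnS_gt _)))// ler_nat ltnS /k leq_maxr.
have : (filter_from [set: nat] U) [set N' | `|F N - F N'| < e].
  by apply: UN; exact: (@cvgr_dist_lt _ _ _ _ _ _ _ (cF N)).
move=> [k0 _ hk0].
have M0 : 0 <= M by rewrite (le_trans _ (FM N)).
(* For such [k], a pseudo-distance of at least [1 / k0.+1] costs at least [2 * M]. *)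
exists (maxn k0 (Num.truncn (2 * M * k0.+1%:R)).+1) => // k /= kk.
rewrite ger0_norm ?subr_ge0 ?envelope_le// lerBlDl -lerBlDr.
apply: envelope_glb => N'; have [NU|NU] := ltP (pm_dist k0 N N') k0.+1%:R^-1.
  have /ltW := hk0 _ NU; rewrite ler_norml => /andP[_ h].
  by apply: ler_wpDr; [rewrite mulr_ge0// pm_dist_ge0|rewrite lerBlDl -lerBlDr].
have h1 : 2 * M <= k%:R * pm_dist k N N'.
  apply: (@le_trans _ _ (k%:R * k0.+1%:R^-1)).
    rewrite ler_pdivlMr ?ltr0n// (le_trans (ltW (truncnS_gt _)))// ler_nat.
    by rewrite (leq_trans _ kk)// leq_maxr.
  rewrite ler_wpM2l// (le_trans NU)// pm_dist_mono//.
  by rewrite (leq_trans _ kk)// leq_maxl.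
have := FM N; have := FM N'; rewrite !ler_norml => /andP[h2 h3] /andP[h4 h5].
by clear -h1 h2 h3 h4 h5 e0; lra.
Qed.

End Envelope.
End CylinderFunctional.

(** * A countable determining family on space-time *)

Section HalfLine.
Context (R : realType).

Lemma set_val_ge0 (s : half_line R) : 0 <= set_val s.
Proof. by have := valP s; rewrite inE /= in_itv /= andbT. Qed.

Lemma to_half_lineK (t : R) : 0 <= t -> set_val (to_half_line t) = t.
Proof.
by move=> t0; rewrite /to_half_line set_valE val_insubd ifT// inE /= in_itv /= t0.
Qed.

Lemma set_val_continuous : continuous (set_val : half_line R -> R).
Proof. exact: initial_continuous. Qed.

(** Negative reals fall on the default point 0; the map is therefore continuous on the whole
    line. *)
Lemma to_half_line_max (t : R) : set_val (to_half_line t) = Num.max t 0.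
Proof.
case: (leP 0 t) => t0; first by rewrite to_half_lineK.
rewrite /to_half_line set_valE val_insubd ifF//.
by apply/negP; rewrite inE /= in_itv /= andbT leNgt t0.
Qed.

Lemma to_half_line_continuous : continuous (@to_half_line R).
Proof.
move=> t A [_ [[C oC <-] Ct CA]].
have : \forall t' \near t, C (Num.max t' 0).
  have cmax : continuous (fun t' : R => Num.max t' 0).
    by move=> x; apply: continuous_max; [exact: cvg_id|exact: cst_continuous].
  apply: (cmax t); apply: open_nbhs_nbhs; split => //.
  by rewrite -to_half_line_max.
by apply: filterS => t' Ct'; apply: CA; rewrite /preimage/= to_half_line_max.
Qed.

Lemma half_line_segment_compact (c : R) : compact [set s : half_line R | set_val s <= c].
Proof.
rewrite (_ : [set s | _] = (@to_half_line R) @` `[0, c]%classic); last first.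
  apply/seteqP; split => [s /= sc|_ [t /= tc <-]].
    exists (set_val s); first by rewrite /= in_itv /= set_val_ge0 sc.
    by apply: val_inj; rewrite -!set_valE to_half_lineK// set_val_ge0.
  by move: tc; rewrite in_itv /= => /andP[t0 tc]; rewrite to_half_lineK.
apply: continuous_compact; last exact: segment_compact.
by apply: continuous_subspaceT; exact: to_half_line_continuous.
Qed.

End HalfLine.

(** * Rational tent functions on space-time *)

Section Tents.
Context (R : realType) (V : pmetricType R).

Lemma mdist_continuous (p : V) : continuous (mdist p).
Proof.
move=> v; apply/cvgrPdist_lt => e e0.
have : nbhs v (ball v e) by exact: nbhsx_ballx.
apply: filterS => v'; rewrite ballEmdist /= => h.
have := metric_triangle p v v'; have := metric_triangle p v' v.
rewrite (metric_sym v' v) ltr_norml => h1 h2.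
by apply/andP; split; lra.
Qed.

Lemma closed_mdist_ball (p : V) (r : R) : closed [set v | mdist p v <= r].
Proof.
rewrite (_ : [set v | _] = mdist p @^-1` [set x : R | x <= r])//.
apply: preimage_closed; first by move=> v _; exact: mdist_continuous.
exact: closed_le.
Qed.

Variable v_ : nat -> V.

(** Spatial centre, time centre, radius, height and slope. All components are countable, hence so
    are the finite lists of tents. *)
Definition tent_index := (nat * rat * rat * rat * nat)%type.

(* A plateau of height [a], supported in the box of radius [r] about
   [(q, v_ i)]. *)
Definition tent (t : tent_index) (z : space_time R V) : R :=
  let '(i, q, r, a, b) := t in
  Num.max 0 (Num.min (ratr a) (b%:R * (ratr r -
    Num.max `|set_val z.1 - ratr q| (mdist (v_ i) z.2)))).

(** Local compactness provides only small compact balls, so the admissible radii depend on the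
    centre. *)
Definition tent_good (t : tent_index) : Prop :=
  let '(i, q, r, a, b) := t in compact [set v | mdist (v_ i) v <= ratr r].

(** Times are already bounded below by 0, so an upper bound suffices for compactness. *)
Definition tent_box (t : tent_index) : set (space_time R V) :=
  let '(i, q, r, a, b) := t in
  [set s : half_line R | set_val s <= ratr q + ratr r] `*` [set v | mdist (v_ i) v <= ratr r].

Definition max_tent (l : seq tent_index) (z : space_time R V) : R :=
  \big[Num.max/0]_(t <- l) tent t z.

Lemma max_tent_ge0 l z : 0 <= max_tent l z.
Proof.
by rewrite /max_tent; elim: l => [|t l ih]; rewrite ?big_nil// big_cons le_max ih orbT.
Qed.

Lemma tent_out_box t z : ~ tent_box t z -> tent t z = 0.
Proof.
case: t => [[[[i q] r] a] b] /= /not_andP h; apply/max_idPl; rewrite ge_min; apply/orP; right.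
rewrite mulr_ge0_le0// subr_le0 le_max; apply/orP.
case: h => /= /negP; rewrite -ltNge => h; [left|by right; exact: ltW].
by rewrite (le_trans _ (ler_norm _))// lerBrDl ltW.
Qed.

Lemma tent_continuous t : continuous (tent t).
Proof.
case: t => [[[[i q] r] a] b] z /=.
have h1 : continuous (fun z : space_time R V => set_val z.1).
  by move=> y; apply: (cvg_comp _ _ (@cvg_fst _ _ (nbhs y.1) (nbhs y.2) _)); exact: set_val_continuous.
have h2 : continuous (fun z : space_time R V => mdist (v_ i) z.2).
  by move=> y; apply: (cvg_comp _ _ (@cvg_snd _ _ (nbhs y.1) (nbhs y.2) _)); exact: mdist_continuous.
pose g1 (z : space_time R V) : R := `|set_val z.1 - ratr q|.
have c1 : continuous g1.
  by move=> y; apply: cvg_norm; apply: cvgB; [exact: h1|exact: cvg_cst].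
pose g2 (z : space_time R V) : R := b%:R * (ratr r - Num.max (g1 z) (mdist (v_ i) z.2)).
have c2 : continuous g2.
  move=> y; apply: cvgM; first exact: cvg_cst.
  apply: cvgB; first exact: cvg_cst.
  exact: (continuous_max (c1 y) (h2 y)).
have c3 : continuous (fun z => Num.min (ratr a) (g2 z)).
  have ca : continuous (fun _ : space_time R V => ratr a : R) by move=> y; exact: cvg_cst.
  by move=> y; exact: (continuous_min (ca y) (c2 y)).
have c0 : continuous (fun _ : space_time R V => 0 : R) by move=> y; exact: cvg_cst.
exact: (continuous_max (c0 z) (c3 z)).
Qed.

Lemma max_tent_continuous l : continuous (max_tent l).
Proof.
elim: l => [|t l ih] z.
  rewrite (_ : max_tent [::] = fun=> 0); first exact: cvg_cst.
  by apply/funext => y; rewrite /max_tent big_nil.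
rewrite (_ : max_tent (t :: l) = fun y => Num.max (tent t y) (max_tent l y)).
  exact: (continuous_max (@tent_continuous t z) (ih z)).
by apply/funext => y; rewrite /max_tent big_cons.
Qed.

Lemma tent_box_closed t : closed (tent_box t).
Proof.
case: t => [[[[i q] r] a] b] /=.
have cA : closed [set s : half_line R | set_val s <= ratr q + ratr r].
  rewrite (_ : [set s | _] = (set_val : half_line R -> R) @^-1` [set x : R | x <= ratr q + ratr r])//.
  apply: preimage_closed; first by move=> s _; exact: set_val_continuous.
  exact: closed_le.
have cB := @closed_mdist_ball (v_ i) (ratr r).
rewrite (_ : _ `*` _ = (fst @^-1` [set s : half_line R | set_val s <= ratr q + ratr r])
  `&` (snd @^-1` [set v | mdist (v_ i) v <= ratr r]))//.
apply: closedI; apply: preimage_closed => //.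
  by move=> z _; exact: cvg_fst.
by move=> z _; exact: cvg_snd.
Qed.

Lemma tent_box_compact t : tent_good t -> compact (tent_box t).
Proof.
case: t => [[[[i q] r] a] b] /= h; apply: compact_setX => //.
exact: half_line_segment_compact.
Qed.

Lemma max_tent_box l : (forall t, t \in l -> tent_good t) ->
  exists K, [/\ closed K, compact K & forall z, ~ K z -> max_tent l z = 0].
Proof.
elim: l => [|t l ih] h.
  by exists set0; split; [exact: closed0|exact: compact0|move=> z _; rewrite /max_tent big_nil].
have [t' t'l|K [clK cK hK]] := ih; first by apply: h; rewrite inE t'l orbT.
exists (tent_box t `|` K); split.
- by apply: closedU => //; exact: tent_box_closed.
- by apply: compactU => //; apply: tent_box_compact; apply: h; exact: mem_head.
move=> z /not_orP[h1 /hK h2]; rewrite /max_tent big_cons -/(max_tent l z) h2.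
by rewrite tent_out_box// maxxx.
Qed.

Lemma norm_maxB_le (x y x' y' L : R) : `|x - x'| <= L -> `|y - y'| <= L ->
  `|Num.max x y - Num.max x' y'| <= L.
Proof.
rewrite !ler_norml => /andP[? ?] /andP[? ?]; rewrite !maxElt.
by case: ltrP => ?; case: ltrP => ?; apply/andP; split; lra.
Qed.

Lemma norm_minB_le (x y x' y' L : R) : `|x - x'| <= L -> `|y - y'| <= L ->
  `|Num.min x y - Num.min x' y'| <= L.
Proof.
rewrite !ler_norml => /andP[? ?] /andP[? ?]; rewrite !minElt.
by case: ltrP => ?; case: ltrP => ?; apply/andP; split; lra.
Qed.

(** The processes to be compared carry the same marks at slightly different times. A Lipschitz bound
    uniform in the mark and a time horizon [K] are what the comparison uses. *)
Definition time_lipschitz (f : space_time R V -> R) (L K : R) :=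
  (forall s s' v, `|f (s, v) - f (s', v)| <= L * `|set_val s - set_val s'|) /\
  (forall s v, K < set_val s -> f (s, v) = 0).

Lemma tent_time_lipschitz t : exists L K : R, 0 <= L /\ time_lipschitz (tent t) L K.
Proof.
case: t => [[[[i q] r] a] b].
exists b%:R, (ratr q + ratr r); split; [by []|split].
  move=> s s' v /=; have bs : 0 <= b%:R * `|set_val s - set_val s'| by rewrite mulr_ge0.
  apply: norm_maxB_le; first by rewrite subrr normr0.
  apply: norm_minB_le; first by rewrite subrr normr0.
  rewrite -mulrBr normrM normr_nat ler_wpM2l//.
  rewrite [X in `|X|](_ : _ = - (Num.max `|set_val s - ratr q| (mdist (v_ i) v) -
    Num.max `|set_val s' - ratr q| (mdist (v_ i) v))); last by ring.
  rewrite normrN; apply: norm_maxB_le; last by rewrite subrr normr0.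
  by apply: (le_trans (ler_dist_dist _ _)); rewrite opprB addrA subrK.
move=> s v sK; apply: tent_out_box => /= -[/= + _].
by rewrite leNgt sK.
Qed.

Lemma max_tent_time_lipschitz l : exists L K : R, 0 <= L /\ time_lipschitz (max_tent l) L K.
Proof.
elim: l => [|t l [L [K [L0 [h1 h2]]]]].
  exists 0, 0; split => //; split => *; rewrite /max_tent !big_nil//.
  by rewrite subrr normr0 mul0r.
have [L' [K' [L'0 [h1' h2']]]] := tent_time_lipschitz t.
exists (L + L'), (Num.max K K'); split; [by rewrite addr_ge0|split].
  move=> s s' v; rewrite /max_tent !big_cons; apply: norm_maxB_le.
    by rewrite (le_trans (h1' _ _ _))// ler_wpM2r// lerDr.
  by rewrite (le_trans (h1 _ _ _))// ler_wpM2r// lerDl.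
move=> s v; rewrite gt_max => /andP[sK sK']; rewrite /max_tent big_cons.
by rewrite h2'// -/(max_tent l _) h2// maxxx.
Qed.

Hypothesis v_dense : forall v (e : R), 0 < e -> exists i, mdist (v_ i) v < e.
Hypothesis hVlc : locally_compact [set: V].

Lemma nbhs_space_time (z0 : space_time R V) (U : set (space_time R V)) :
  nbhs z0 U -> exists2 e : R, 0 < e & forall z,
    `|set_val z.1 - set_val z0.1| < e -> mdist z0.2 z.2 < e -> U z.
Proof.
move=> [[P Q] /= [[_ [[C oC <-] Cz CP]] hQ] PQU].
have /nbhs_ballP[e1 /= e10 h1] : nbhs (set_val z0.1 : R) C by exact: open_nbhs_nbhs.
have /nbhs_ballP[e2 /= e20 h2] := hQ.
exists (Num.min e1 e2) => [|[s v] /=]; first by rewrite lt_min e10.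
rewrite !lt_min => /andP[hs _] /andP[_ hv]; apply: PQU; split => /=.
  by apply: CP; apply: h1; rewrite /ball/= distrC.
by apply: h2; rewrite ballEmdist.
Qed.

Lemma compact_ball_exists (v : V) : exists2 e : R, 0 < e &
  forall K, closed K -> (forall v', K v' -> mdist v v' < e) -> compact K.
Proof.
have [W /= hW [cW _]] := hVlc (I : [set: V] v).
have /nbhs_ballP[e /= e0 h] : nbhs v W.
  apply: (@filterS _ (nbhs v) _ (fun v' => [set: V] v' -> W v')) hW.
  by move=> v' h; exact: h.
exists e => // K clK hK; apply: (subclosed_compact clK cW).
by move=> v' /hK v'e; apply: h; rewrite ballEmdist.
Qed.

Lemma local_tent (z0 : space_time R V) (U : set (space_time R V)) (a : rat) :
  nbhs z0 U -> 0 <= (ratr a : R) -> exists t,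
  [/\ tent_good t, tent t z0 = ratr a, (forall z, tent t z <= ratr a) &
      (forall z, ~ U z -> tent t z = 0)].
Proof.
move=> /nbhs_space_time[e1 e10 hU] a0.
have [e2 e20 hK] := compact_ball_exists z0.2.
pose e := Num.min e1 e2.
have e0 : 0 < e by rewrite lt_min e10.
have e4 : 0 < e / 4 by rewrite divr_gt0.
have [i hi] := v_dense z0.2 e4.
have [q] : exists q : rat, ratr q \in `]set_val z0.1 - e / 4, set_val z0.1 + e / 4[.
  by apply: rat_in_itvoo; rewrite ltrBlDr -addrA ltrDl addr_gt0.
rewrite in_itv /= => hq.
(* The centre lies within [e / 4] of [z0]: a radius above [e / 4] encloses [z0], and one below
   [e / 2] keeps the tent inside [U]. *)
have [r] : exists r : rat, ratr r \in `]e / 4, e / 2[.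
  by apply: rat_in_itvoo; lra.
rewrite in_itv /= => /andP[r1 r2].
have hm : Num.max `|set_val z0.1 - ratr q| (mdist (v_ i) z0.2) < ratr r.
  rewrite gt_max (lt_trans hi r1) andbT (lt_trans _ r1)//.
  by rewrite ltr_norml; move: hq => /andP[? ?]; apply/andP; split; lra.
(* The slope is steep enough for the ramp to reach the height [a] at [z0]. *)
pose b := (Num.truncn ((ratr a : R) / (ratr r - Num.max `|set_val z0.1 - ratr q| (mdist (v_ i) z0.2)))).+1.
exists (i, q, r, a, b); split => /=.
- apply: hK; first exact: closed_mdist_ball.
  move=> v' /= hv'; apply: (le_lt_trans (metric_triangle _ (v_ i) _)).
  rewrite metric_sym.
  have : e <= e2 by rewrite ge_min lexx orbT.
  clear -hi hv' r2 e0; lra.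
- rewrite max_r; last by rewrite le_min a0 mulr_ge0// subr_ge0 ltW.
  apply/min_idPl; rewrite -ler_pdivrMr ?subr_gt0//.
  by rewrite ltW// truncnS_gt.
- by move=> z; rewrite ge_max a0 ge_min lexx.
move=> z hz; apply/max_idPl; rewrite ge_min; apply/orP; right.
rewrite mulr_ge0_le0// subr_le0 leNgt; apply/negP; rewrite gt_max => /andP[h1 h2].
apply: hz; apply: hU.
  have : e <= e1 by rewrite ge_min lexx.
  move: h1 hq; rewrite !ltr_norml => /andP[? ?] /andP[? ?] ?.
  by apply/andP; split; lra.
apply: (le_lt_trans (metric_triangle _ (v_ i) _)); rewrite metric_sym.
have : e <= e1 by rewrite ge_min lexx.
by clear -hi h2 r2 e0; lra.
Qed.

(** One tent is added per point of [s] where [f] exceeds [e], with a rational height between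
    [f z0 - e] and [f z0] and supported where [f] is above that height; the maximum thus stays below
    [f]. *)
Lemma max_tent_approx (f : space_time R V -> R) (s : seq (space_time R V)) (e : R) :
  continuous f -> (forall z, 0 <= f z) -> 0 < e ->
  exists l, [/\ (forall t, t \in l -> tent_good t), (forall z, max_tent l z <= f z) &
    (forall z, z \in s -> f z - e <= max_tent l z)].
Proof.
move=> cf f0 e0; elim: s => [|z0 s [l [lg lf ls]]].
  by exists [::]; split => // z; rewrite /max_tent big_nil.
have [fe|fe] := leP (f z0) e.
  exists l; split => // z; rewrite inE => /orP[/eqP ->|]; last exact: ls.
  by rewrite (@le_trans _ _ 0) ?max_tent_ge0// subr_le0.
have [a] : exists a : rat, ratr a \in `]f z0 - e, f z0[.
  by apply: rat_in_itvoo; rewrite ltrBlDr ltrDl.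
rewrite in_itv /= => /andP[a1 a2].
have a0 : 0 <= (ratr a : R) by rewrite (le_trans _ (ltW a1))// subr_ge0 ltW.
have nU : nbhs z0 [set z | ratr a < f z].
  by have := cf z0 => /cvgr_gt; exact.
have [t [tg tz ta tU]] := local_tent nU a0.
exists (t :: l); split.
- by move=> t'; rewrite inE => /orP[/eqP ->|/lg].
- move=> z; rewrite /max_tent big_cons ge_max -/(max_tent l z) lf andbT.
  have [zU|zU] := pselect ([set z | ratr a < f z] z); last by rewrite tU.
  by rewrite (le_trans (ta z))// ltW.
move=> z; rewrite inE /max_tent big_cons le_max -/(max_tent l z) => /orP[/eqP ->|/ls ->].
  by rewrite tz (ltW a1).
by rewrite orbT.
Qed.

(** By compactness, finitely many tents of height 1 exceed 1/2 somewhere over each point of the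
    support; twice the bound on [f] then works as a factor. *)
Lemma max_tent_dominates (f : test_function (space_time R V) R) :
  exists l (k : nat), (forall t, t \in l -> tent_good t) /\ forall z, f z <= k%:R * max_tent l z.
Proof.
have [M M0 fM] := test_function_bounded f.
have := @test_compact _ _ f; rewrite compact_cover => /(_ _ tent_good
  (fun t => [set z | 2^-1 < tent t z])) [].
- move=> t _; rewrite (_ : [set z | _] = tent t @^-1` [set x : R | 2^-1 < x])//.
  apply: open_comp; first by move=> z _; exact: tent_continuous.
  exact: open_gt.
- move=> z _; have nT : nbhs z [set: space_time R V] by exact: filterT.
  have one0 : 0 <= (ratr 1 : R) by rewrite rmorph1.
  have [t [tg tz _ _]] := local_tent nT one0.
  by exists t => //=; rewrite tz rmorph1 invf_lt1// ltr1n.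
move=> D' D'g D'c; exists (finmap.enum_fset D'), (Num.truncn (2 * M)).+1; split.
  by move=> t /D'g; rewrite inE.
move=> z; have [fz|fz] := eqVneq (f z) 0; first by rewrite fz mulr_ge0// max_tent_ge0.
have /D'c [t /= tD' tz] : closure [set z | f z != 0] z by exact: subset_closure.
have tle : tent t z <= max_tent (finmap.enum_fset D') z.
  have : t \in finmap.enum_fset D' by [].
  rewrite /max_tent; elim: (finmap.enum_fset D') => // t' l ih.
  rewrite inE big_cons le_max => /orP[/eqP ->|/ih ->]; rewrite ?lexx// orbT//.
apply: (le_trans (ler_norm _)); apply: (le_trans (fM z)).
apply: (@le_trans _ _ ((2 * M) * max_tent (finmap.enum_fset D') z)).
  have : 2^-1 <= max_tent (finmap.enum_fset D') z by rewrite (le_trans _ tle)// ltW.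
  move=> h; rewrite mulrAC ler_peMl// mulrC -ler_pdivrMr// mul1r//.
by rewrite ler_wpM2r ?max_tent_ge0// ltW// truncnS_gt.
Qed.

Lemma determining_tents : exists c : nat -> test_function (space_time R V) R,
  determining c /\ forall j, exists L K : R, 0 <= L /\ time_lipschitz (c j) L K.
Proof.
(* Every integer decodes to a list of tents; discarding those without compact support makes each
   [c j] a test function. *)
pose lj (j : nat) := [seq t <- odflt [::] (unpickle j : option (seq tent_index)) | `[< tent_good t >]].
have ljg j t : t \in lj j -> tent_good t by rewrite mem_filter => /andP[/asboolP].
have ex j : exists g : test_function (space_time R V) R, g = max_tent (lj j) :> (_ -> _).
  have [K [clK cK hK]] := max_tent_box (@ljg j).
  exact: (test_function_exists (@max_tent_continuous _) clK cK hK).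
have [c cE] := choice ex.
have cover l : (forall t, t \in l -> tent_good t) -> exists j, c j = max_tent l :> (_ -> _).
  move=> lg; exists (pickle (l : seq tent_index)); rewrite cE /lj pickleK /=.
  congr max_tent; apply/all_filterP/allP => t tl; apply/asboolP; exact: lg.
exists c; split; last by move=> j; rewrite cE; exact: max_tent_time_lipschitz.
split.
- by move=> j z; rewrite cE max_tent_ge0.
- move=> f s e f0 e0.
  have [l [lg lf ls]] := max_tent_approx s (@test_continuous _ _ f) f0 e0.
  have [j jE] := cover l lg; exists j => z; rewrite jE; [exact: lf|exact: ls].
- move=> f; have [l [k [lg lf]]] := max_tent_dominates f.
  by have [j jE] := cover l lg; exists j, k => z; rewrite jE; exact: lf.
Qed.

End Tents.

Lemma second_countable_dense (R : realType) (V : pmetricType R) :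
  @second_countable V ->
  exists v_ : nat -> V, forall v (e : R), 0 < e -> exists i, mdist (v_ i) v < e.
Proof.
move=> [B cB [Bo hB]].
have hv v (e : R) : 0 < e -> exists2 U, B U & U v /\ U `<=` ball v e.
  move=> e0; have [U [BU Uv] Ue] := hB v _ (nbhsx_ballx v e e0).
  by exists U.
have [B0|] := pfcard_geP cB.
  exists (fun=> point) => v e e0; have [U] := hv v e e0.
  by rewrite B0.
move=> [f]; exists (fun i => get (f i)) => v e e0.
have [U BU [Uv Ue]] := hv v e e0.
have [i _ fi] : (f @` [set: nat]) U by rewrite image_eq.
exists i; rewrite fi; have /Ue : U (get U) by apply: getI; exact: Uv.
by rewrite ballEmdist /= metric_sym.
Qed.

(** * The base process *)

Section TimedPoints.
Context (R : realType) (V : pmetricType R).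
Variables (D : set nat) (th : nat -> R) (h : nat -> V).

Let z n : borel (space_time R V) := (to_half_line (th n), h n).

(** A compact set has a bounded time projection, which only finitely many of the points can meet. *)
Lemma timed_points_is_point_measure :
  (forall c, exists n0, forall n, D n -> (n0 <= n)%N -> c < th n) ->
  is_point_measure (fun B : set (space_time R V) => (\esum_(n in D) (\d_(z n) B : \bar R))%E).
Proof.
move=> thy; split; first by exists D, z.
move=> K cK.
have cK' : compact [set set_val w.1 | w in K].
  apply: continuous_compact cK; apply: continuous_subspaceT => y.
  by apply: (cvg_comp _ _ (@cvg_fst _ _ (nbhs y.1) (nbhs y.2) _)); exact: set_val_continuous.
have [M [_ hM]] := compact_bounded cK'.
have [n0 hn0] := thy (M + 1).
rewrite (esumID `I_n0)//.
rewrite [X in (_ + X)%E]esum1 ?adde0; last first.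
  move=> n [Dn /= /negP]; rewrite -leqNgt => n0n; rewrite diracE.
  rewrite (_ : (z n \in K) = false)//.
  apply/negP; rewrite inE => Kz.
  have : `|set_val (z n).1| <= M + 1 by apply: hM; [rewrite ltrDl|exists (z n)].
  rewrite /z /= to_half_line_max ger0_norm ?le_max ?lexx ?orbT// ge_max => /andP[+ _].
  by rewrite leNgt hn0.
rewrite esum_fset//; last by apply: finite_setIr; exact: finite_II.
rewrite fsbig_finite/=; last by apply: finite_setIr; exact: finite_II.
by rewrite sumEFin ltry.
Qed.

Lemma timed_points_integral (N : point_measure (space_time R V) R)
    (f : test_function (space_time R V) R) (K : R) n0 :
  (forall B, N B = (\esum_(n in D) \d_(z n) B)%E) -> (forall y, 0 <= f y) ->
  (forall s v, K < set_val s -> f (s, v) = 0) ->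
  (forall n, D n -> (n0 <= n)%N -> K < th n) ->
  pm_integral N f = \sum_(n < n0) \1_D n * f (z n).
Proof.
move=> NE f0 fK thK; apply: EFin_inj; rewrite (ge0_pm_integral NE f0).
rewrite (esumID `I_n0)//; last by move=> n _; rewrite lee_fin.
rewrite [X in (_ + X)%E]esum1 ?adde0; last first.
  move=> n [Dn /= /negP]; rewrite -leqNgt => n0n; congr EFin; apply: fK.
  by rewrite to_half_line_max lt_max thK.
rewrite setIC esum_mkcondr esum_fset//; last first.
  by move=> n _; case: ifP; rewrite ?lee_fin.
rewrite -fsbig_ord -sumEFin; apply: eq_bigr => i _.
by rewrite indicE; case: ifP; rewrite ?mul1r ?mul0r.
Qed.

End TimedPoints.

Lemma to_point_measureE (E : ptopologicalType) (R : realType) (N : set E -> \bar R) :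
  is_point_measure N -> (to_point_measure N : set E -> \bar R) = N.
Proof. by move=> h; rewrite /to_point_measure; case: pselect. Qed.

Section BaseProcess.
Context d (Om : measurableType d) (R : realType) (mu : probability Om R).
Variables (T : Om -> Om) (V : pmetricType R) (A : set Om) (H : Om -> V).
Hypothesis hT : measure_preserving mu T.
Hypotheses (mA : measurable A) (mH : measurable_fun A (H : Om -> borel V)).
Let a := fine (mu A).
Hypothesis a0 : 0 < a.

Let hits x := [set n : nat | (1 <= n)%N /\ A (iter n T x)].

(** Since [a] is positive, the times [n * a] tend to infinity and the process is locally finite at
    every [x]: the null default is never taken. *)
Lemma base_processE x B : base_process mu T A H x B =
  (\esum_(n in hits x) \d_((to_half_line (n%:R * a), H (iter n T x)) : borel (space_time R V)) B)%E.
Proof.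
rewrite to_point_measureE//; apply: timed_points_is_point_measure => c.
exists (Num.truncn (c / a)).+1 => n _ hn.
rewrite -ltr_pdivrMr// (lt_le_trans (truncnS_gt _))// ler_nat//.
Qed.

Lemma sum_hitsS (x : Om) n0 (F : nat -> R) :
  \sum_(n < n0.+1) \1_(hits x) n * F n = \sum_(n < n0) \1_A (iter n.+1 T x) * F n.+1.
Proof.
rewrite big_ord_recl [X in X * _](_ : _ = 0) ?mul0r ?add0r; last first.
  by rewrite indicE memNset// => -[].
apply: eq_bigr => i _; congr (_ * _); rewrite !indicE; congr (nat_of_bool _)%:R.
by apply/idP/idP; rewrite !inE; [case|split].
Qed.

Lemma base_process_integral x (f : test_function (space_time R V) R) (K : R) n0 :
  (forall y, 0 <= f y) -> (forall s v, K < set_val s -> f (s, v) = 0) ->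
  K < n0.+1%:R * a ->
  pm_integral (base_process mu T A H x) f =
  \sum_(n < n0) \1_A (iter n.+1 T x) * f (to_half_line (n.+1%:R * a), H (iter n.+1 T x)).
Proof.
move=> f0 fK Kn0.
rewrite (@timed_points_integral _ _ (hits x) (fun n => n%:R * a)
  (fun n => H (iter n T x)) _ _ K n0.+1)//.
- exact: (@sum_hitsS x n0 (fun n => f (to_half_line (n%:R * a), H (iter n T x)))).
- by move=> B; rewrite base_processE.
- by move=> n _ hn; rewrite (lt_le_trans Kn0)// ler_wpM2r ?(ltW a0)// ler_nat.
Qed.

(** With the time frozen, only the section of [f] at [s] is composed with [H], whose measurability
    is known on [A] alone; the indicator removes the rest. *)
Lemma measurable_indic_comp (f : space_time R V -> R) (s : half_line R) :
  continuous f -> measurable_fun setT (fun x => \1_A x * f (s, H x)).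
Proof.
move=> cf; rewrite (_ : (fun x => _) = (fun x => f (s, H x)) \_ A).
  apply/(measurable_restrictT _ mA).
  have cfs : continuous (fun v => f (s, v)).
    move=> v U /(cf (s, v)) [[P Q] /= [h1 h2] PQ].
    apply: (@filterS _ (nbhs v) _ Q) h2 => v' Qv'; apply: (PQ (s, v')); split => //.
    exact: nbhs_singleton h1.
  exact: (measurableT_comp (continuous_borel_measurable cfs) mH).
apply/funext => x; rewrite patchE indicE; case: ifP; rewrite ?mul1r ?mul0r//.
Qed.

Lemma measurable_base_process_integral (f : test_function (space_time R V) R) (K : R) :
  (forall y, 0 <= f y) -> (forall s v, K < set_val s -> f (s, v) = 0) ->
  measurable_fun setT (fun x => pm_integral (base_process mu T A H x) f).
Proof.
move=> f0 fK; pose n0 := Num.truncn (K / a).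
have Kn0 : K < n0.+1%:R * a by rewrite -ltr_pdivrMr// truncnS_gt.
under eq_fun do rewrite (base_process_integral _ f0 fK Kn0).
apply: measurable_sum => i.
apply: (measurableT_comp (measurable_indic_comp (to_half_line (i.+1%:R * a)) (@test_continuous _ _ f))).
exact: (measurable_iter hT i.+1).
Qed.

Lemma Rintegral_visit n : \int[mu]_x \1_A (iter n T x) = a.
Proof.
transitivity (fine (mu (iter n T @^-1` A))); last by rewrite (measure_preimage_iter hT).
congr fine; have := integral_indic mu measurableT (measurable_preimage_iter hT n mA).
by rewrite setIT => <-; apply: eq_integral.
Qed.

Lemma measurable_visit n : measurable_fun setT (fun x => \1_A (iter n T x) : R).
Proof.
have m1 : measurable_fun setT (\1_A : Om -> R) by exact: measurable_indic.
exact: (measurableT_comp m1 (measurable_iter hT n)).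
Qed.

Lemma measurable_visit_sum (n0 m : nat) :
  measurable_fun setT (fun x => \sum_(n < n0) \1_A (iter (n + m) T x) : R).
Proof. by apply: measurable_sum => n; exact: measurable_visit. Qed.

Lemma visit_sum_bounded (n0 m : nat) x :
  `|\sum_(n < n0) \1_A (iter (n + m) T x) : R| <= n0%:R.
Proof.
apply: (le_trans (ler_norm_sum _ _ _)).
rewrite -[n0 in leRHS]card_ord -sumr_const; apply: ler_sum => i _.
by rewrite indicE; case: (_ \in _); rewrite ?normr1// normr0.
Qed.

Lemma integrable_visit_sum (n0 m : nat) :
  mu.-integrable setT (EFin \o (fun x => \sum_(n < n0) \1_A (iter (n + m) T x) : R)).
Proof.
apply: bounded_integrable; first exact: measurable_visit_sum.
exact: visit_sum_bounded.
Qed.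

Lemma Rintegral_visit_sum (n0 m : nat) :
  \int[mu]_x (\sum_(n < n0) \1_A (iter (n + m) T x)) = n0%:R * a.
Proof.
elim: n0 => [|n0 ih].
  rewrite mul0r /Rintegral (_ : (fun=> _) = cst 0%E) ?integral0//.
  by apply/funext => x; rewrite big_ord0.
rewrite -natr1 mulrDl mul1r -ih -(Rintegral_visit (n0 + m)) -RintegralD//.
- by apply: eq_Rintegral => x _; rewrite big_ord_recr.
- exact: integrable_visit_sum.
- apply: (@bounded_integrable _ _ _ _ _ 1); first exact: measurable_visit.
  by move=> x; rewrite indicE; case: (_ \in _); rewrite ?normr1// normr0.
Qed.

Lemma base_process_shift x (f : test_function (space_time R V) R) (L K B : R) n0 :
  (forall y, 0 <= f y) -> (forall y, `|f y| <= B) -> 0 <= L ->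
  time_lipschitz f L K -> K < n0.+1%:R * a ->
  `|pm_integral (base_process mu T A H (T x)) f - pm_integral (base_process mu T A H x) f|
  <= B * \1_A (T x) + L * a * \sum_(n < n0) \1_A (iter (n + 2) T x).
Proof.
move=> f0 fB L0 [fL fK] Kn0.
(* The sum at [x] is given one more term than the sum at [T x]: once the visit at time 1 is split
   off, the two match term by term. *)
have Kn1 : K < n0.+2%:R * a by rewrite (lt_le_trans Kn0)// ler_wpM2r ?(ltW a0)// ler_nat.
rewrite (base_process_integral _ f0 fK Kn0) (base_process_integral _ f0 fK Kn1).
rewrite big_ord_recl opprD addrCA.
apply: (le_trans (ler_normD _ _)); apply: lerD.
  rewrite normrN normrM mulrC; rewrite (ger0_norm (_ : 0 <= \1_A _))//.
  by rewrite ler_wpM2r.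
rewrite -sumrB mulr_sumr; apply: (le_trans (ler_norm_sum _ _ _)); apply: ler_sum => i _.
rewrite -!iterSr !lift0 addn2.
rewrite -mulrBr normrM (ger0_norm (_ : 0 <= \1_A _))// mulrC ler_wpM2r//.
apply: (le_trans (fL _ _ _)); rewrite ler_wpM2l//.
rewrite !to_half_lineK ?mulr_ge0 ?(ltW a0)//.
rewrite -mulrBl -[i.+2%:R]natr1 opprD addrA subrr sub0r mulN1r normrN ger0_norm//.
exact: ltW.
Qed.

(* The first visit is dropped and the other points move by [mu A], so the cost
   is of order [mu A] times a number of visits of bounded expectation. *)
Lemma base_process_almost_invariant (f : test_function (space_time R V) R) (L K B : R) n0 :
  (forall y, 0 <= f y) -> (forall y, `|f y| <= B) -> 0 <= L ->
  time_lipschitz f L K -> K < n0.+1%:R * a ->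
  \int[mu]_x `|pm_integral (base_process mu T A H (T x)) f - pm_integral (base_process mu T A H x) f|
  <= a * (B + L * (n0%:R * a)).
Proof.
move=> f0 fB L0 fLK Kn0.
have B0 : 0 <= B by rewrite (le_trans _ (fB point)).
have i1 : mu.-integrable setT (EFin \o (fun x => B * \1_A (T x))).
  apply: (@bounded_integrable _ _ _ _ _ B).
    by apply: measurable_funM => //; exact: (measurable_visit 1).
  move=> x; rewrite indicE normrM ger0_norm//; case: (_ \in _).
    by rewrite normr1 mulr1.
  by rewrite normr0 mulr0.
have i2 : mu.-integrable setT (EFin \o (fun x => L * a * \sum_(n < n0) \1_A (iter (n + 2) T x))).
  exact: (integrableZl measurableT (L * a) (integrable_visit_sum n0 2)).
apply: (@le_trans _ _ (\int[mu]_x (B * \1_A (T x) + L * a * \sum_(n < n0) \1_A (iter (n + 2) T x)))).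
  apply: (@le_Rintegral_all _ _ _ _ _ _ (B + L * a * n0%:R)).
  - move=> x; rewrite normr_id (le_trans (base_process_shift x f0 fB L0 fLK Kn0))//.
    rewrite lerD//; first by rewrite indicE; case: (_ \in _); rewrite ?mulr1// mulr0.
    by rewrite ler_wpM2l ?mulr_ge0 ?(ltW a0)// (le_trans (ler_norm _)) ?visit_sum_bounded.
  - move=> x; apply: (le_trans (ler_normD _ _)); rewrite lerD//.
      rewrite indicE normrM ger0_norm//; case: (_ \in _); rewrite ?normr1 ?mulr1//.
      by rewrite normr0 mulr0.
    by rewrite normrM ger0_norm ?mulr_ge0 ?(ltW a0)// ler_wpM2l ?mulr_ge0 ?(ltW a0)// visit_sum_bounded.
  - by move=> x; exact: (base_process_shift x f0 fB L0 fLK Kn0).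
rewrite RintegralD//.
have -> : \int[mu]_x (B * \1_A (T x)) = B * a.
  rewrite RintegralZl//; first by rewrite (Rintegral_visit 1).
  apply: (@bounded_integrable _ _ _ _ _ 1); first exact: (measurable_visit 1).
  by move=> x; rewrite indicE; case: (_ \in _); rewrite ?normr1// normr0.
rewrite RintegralZl//; last exact: integrable_visit_sum.
rewrite Rintegral_visit_sum le_eqVlt; apply/orP; left; apply/eqP; ring.
Qed.

End BaseProcess.

(** * The flow process *)

Lemma supremum_nat_max (X : set nat) n :
  X n -> (forall k, X k -> (k <= n)%N) -> supremum 0%N X = n.
Proof.
move=> Xn nX; have sn : supremums X n by split => // b; exact.
have X0 : (X == set0) = false by apply/eqP => X0; move: Xn; rewrite X0.
by rewrite /supremum X0; case: xgetP => [y _ sy|/(_ n)//]; exact: is_subset1_supremums sy sn.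
Qed.

Lemma markov_fine d (Om : measurableType d) (R : realType) (P : probability Om R)
    (X : Om -> R) (M : R) :
  P.-integrable setT (EFin \o X) -> (forall x, 0 <= X x) -> 0 < M ->
  fine (P [set x | M < X x]) <= (\int[P]_x X x) / M.
Proof.
move=> Xi X0 M0; have mX : measurable_fun setT X by apply/measurable_EFinP; case/integrableP: Xi.
have mB : measurable [set x | M < X x].
  by rewrite -[X in measurable X]setTI; exact: measurable_fun_ltr.
rewrite ler_pdivlMr// mulrC.
have -> : fine (P [set x | M < X x]) = \int[P]_x \1_[set x | M < X x] x.
  by rewrite /Rintegral integral_indic// setIT.
have iB : P.-integrable setT (EFin \o (\1_[set x | M < X x] : Om -> R)).
  apply: (@bounded_integrable _ _ _ _ _ 1); first exact: measurable_indic.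
  by move=> x; rewrite indicE; case: (_ \in _); rewrite ?normr1// normr0.
rewrite -RintegralZl//; apply: le_Rintegral => //.
  exact: (integrableZl measurableT M iB).
move=> x _; rewrite indicE; case: (boolP (x \in _)); last by rewrite mulr0.
by rewrite inE /= mulr1 => /ltW.
Qed.

Lemma time_lipschitzW (R : realType) (V : pmetricType R) (f : space_time R V -> R) L K L' K' :
  L <= L' -> K <= K' -> time_lipschitz f L K -> time_lipschitz f L' K'.
Proof.
move=> LL KK [h1 h2]; split => [s s' v|s v sK].
  by rewrite (le_trans (h1 _ _ _))// ler_wpM2r.
by apply: h2; exact: le_lt_trans sK.
Qed.

Section FlowProcess.
Context d (Om : measurableType d) (R : realType) (mu : probability Om R).
Variables (T : Om -> Om) (tau : Om -> R) (V : pmetricType R) (A : set Om) (H : Om -> V).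
Hypothesis htau : forall x, 0 < tau x.
Hypothesis htauint : mu.-integrable setT (EFin \o tau).

Let a := fine (mu A).
Let tb := mean_roof mu tau.
Let S n x := birkhoff_sum T tau n x.
Let hits x := [set n : nat | (1 <= n)%N /\ A (iter n T x)].

Lemma mean_roof_gt0 : 0 < tb.
Proof.
rewrite lt_neqAle Rintegral_ge0 ?andbT//; last by move=> x _; exact: ltW.
apply/eqP => tb0.
have mtau : measurable_fun setT (EFin \o tau) by case/integrableP: htauint.
have : (\int[mu]_x `|(EFin \o tau) x|)%E = 0%E.
  rewrite (_ : (fun x => _) = EFin \o tau); last first.
    by apply/funext => x /=; rewrite ger0_norm// ltW.
  rewrite -[LHS]fineK; last exact: integrable_fin_num.
  by move: tb0; rewrite /tb /mean_roof /Rintegral => <-.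
move=> /(ae_eq_integral_abs mu measurableT mtau) [N [mN N0 hN]].
have NT : N = setT.
  apply/seteqP; split => // x _; apply: hN => /= /(_ I) [].
  by apply/eqP; rewrite gt_eqF.
have := probability_setT mu; rewrite -NT => /(etrans (esym N0)) /eqP.
by rewrite eq_sym onee_eq0.
Qed.

Lemma birkhoff_sum_lt x n k : (n < k)%N -> S n x < S k x.
Proof.
have SS j : S j x < S j.+1 x by rewrite /S /birkhoff_sum big_ord_recr/= ltrDl.
elim: k => // k ih; rewrite ltnS leq_eqVlt => /orP[/eqP ->|/ih h] //.
exact: lt_trans h (SS k).
Qed.

Lemma birkhoff_sum_leE x n k : (S n x <= S k x) = (n <= k)%N.
Proof.
case: (leqP n k) => [|h].
  by rewrite leq_eqVlt => /orP[/eqP ->|/(birkhoff_sum_lt x)/ltW ->]; rewrite ?lexx.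
by apply/negbTE; rewrite -ltNge birkhoff_sum_lt.
Qed.

(** A positive roof makes the Birkhoff sums strictly increasing, so the supremum is attained at [n]
    exactly. *)
Lemma flow_count_hit x t n : flow_count T tau (S n x - t) (x, t) = n.
Proof.
apply: supremum_nat_max; first by rewrite /= subrKC.
by move=> k /=; rewrite subrKC birkhoff_sum_leE.
Qed.

(** Height 0 at time [s] forces [s] to be [S n x - t]. The condition [s > 0] excludes [n = 0], since
    [t] is nonnegative, and holds for [n >= 1], since [t] is below the roof [S 1 x]. *)
Lemma flow_hits x t : 0 <= t < tau x ->
  [set s | 0 < s /\ (A `*` [set 0]) (special_flow T tau s (x, t))] =
  [set S n x - t | n in hits x].
Proof.
move=> /andP[t0 tt]; apply/seteqP; split => [s [s0 [/= As Ss]]|_ [n [n1 An] <-]].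
  move: As Ss; rewrite /special_flow /=; set n := flow_count _ _ _ _ => An Sn.
  have sE : s = S n x - t by rewrite /S -(subr0_eq Sn) addrC addKr.
  exists n => //; split => //; rewrite lt0n; apply/eqP => n0.
  by move: s0; rewrite sE n0 /S /birkhoff_sum big_ord0 sub0r oppr_gt0 ltNge t0.
split.
  rewrite subr_gt0 (lt_le_trans tt)// (_ : tau x = S 1 x) ?birkhoff_sum_leE//.
  by rewrite /S /birkhoff_sum big_ord1.
rewrite /special_flow flow_count_hit; split => //=.
by rewrite subrKC subrr.
Qed.

Lemma flow_processE x t B : 0 < a -> 0 <= t < tau x ->
  (forall c, exists n, c < S n x) ->
  flow_process mu T tau A H (x, t) B =
  (\esum_(n in hits x) \d_((to_half_line ((S n x - t) * a / tb), H (iter n T x)) : borel (space_time R V)) B)%E.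
Proof.
move=> a0 ht hS; rewrite /flow_process -/a -/tb.
set N := (X in to_point_measure X).
have NE : N = fun B => (\esum_(n in hits x) \d_((to_half_line ((S n x - t) * a / tb), H (iter n T x)) : borel (space_time R V)) B)%E.
  apply/funext => B'; rewrite /N flow_hits// esum_image; last first.
    move=> n k _ _ /addIr; case: (ltngtP n k) => // /(birkhoff_sum_lt x) h /eqP.
      by rewrite lt_eqF.
    by rewrite gt_eqF.
  apply: eq_esum => n _.
  by rewrite /special_flow flow_count_hit.
rewrite to_point_measureE NE//; apply: timed_points_is_point_measure => c.
have tb0 := mean_roof_gt0.
have [n0 hn0] := hS (c * tb / a + t); exists n0 => n _ n0n.
rewrite ltr_pdivlMr// -ltr_pdivrMr// ltrBrDr (lt_le_trans hn0)//.
by rewrite birkhoff_sum_leE.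
Qed.

Lemma flow_process_integral x t (f : test_function (space_time R V) R) (K : R) n0 :
  0 < a -> 0 <= t < tau x -> (forall c, exists n, c < S n x) ->
  (forall y, 0 <= f y) -> (forall s v, K < set_val s -> f (s, v) = 0) ->
  (forall n, (n0.+1 <= n)%N -> K < (S n x - t) * a / tb) ->
  pm_integral (flow_process mu T tau A H (x, t)) f =
  \sum_(n < n0) \1_A (iter n.+1 T x) *
    f (to_half_line ((S n.+1 x - t) * a / tb), H (iter n.+1 T x)).
Proof.
move=> a0 ht hS f0 fK hK.
rewrite (@timed_points_integral _ _ (hits x) (fun n => (S n x - t) * a / tb)
  (fun n => H (iter n T x)) _ _ K n0.+1)//.
- exact: (@sum_hitsS _ _ R T A x n0 (fun n => f (to_half_line ((S n x - t) * a / tb), H (iter n T x)))).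
- by move=> B; rewrite flow_processE.
- by move=> n _; exact: hK.
Qed.

(* [|S n x - n tb| <= e n + C] turns the flow time [(S n x - t) a / tb] into
   the base time [n a], up to an error which is small when [n a] is bounded. *)
Lemma flow_process_close x t (f : test_function (space_time R V) R) (L K e : R) (C n0 : nat) :
  0 < a -> 0 <= t < tau x -> t <= C%:R -> birkhoff_set mu T tau e C x ->
  0 <= e -> e <= tb / 2 -> 2 * C%:R * a / tb <= 1 ->
  (forall y, 0 <= f y) -> 0 <= L -> 0 <= K -> time_lipschitz f L K ->
  2 * K + 2 < n0.+1%:R * a ->
  `|pm_integral (flow_process mu T tau A H (x, t)) f - pm_integral (base_process mu T A H x) f|
  <= L * ((e * (n0%:R * a) + 2 * C%:R * a) / tb) * \sum_(n < n0) \1_A (iter (n + 1) T x).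
Proof.
move=> a0 ht tC hx e0 et Ca f0 L0 K0 [fL fK] Kn0.
have tb0 := mean_roof_gt0.
have [t0 _] := andP ht.
have hB n : `|S n x - n%:R * tb| <= e * n%:R + C%:R by exact: hx.
(* As [e] is at most half the mean roof, the hitting times still grow linearly; one [C] bounds the
   Birkhoff error and the other the height [t]. *)
have hlow n : n%:R * tb / 2 - 2 * C%:R <= S n x - t.
  have := hB n; rewrite ler_norml => /andP[h _].
  have h2 : e * n%:R <= tb / 2 * n%:R by rewrite ler_wpM2r.
  by clear -h h2 tC; lra.
have hS c : exists n, c < S n x.
  exists (Num.truncn (`|c + 2 * C%:R| / (tb / 2))).+1.
  have := hlow (Num.truncn (`|c + 2 * C%:R| / (tb / 2))).+1.
  have := truncnS_gt (`|c + 2 * C%:R| / (tb / 2)); rewrite ltr_pdivrMr ?divr_gt0//.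
  have := ler_norm (c + 2 * C%:R).
  set q := (_.+1)%:R => h1 h2 h3; clear -h1 h2 h3 t0; lra.
(* The rescaled time is at least [n * a / 2 - 1], and [n * a] exceeds [2 * K + 2]. Both sums can
   thus be cut at the same [n0]. *)
have Kbig n : (n0.+1 <= n)%N -> K < (S n x - t) * a / tb.
  move=> nn; rewrite ltr_pdivlMr//; rewrite ler_pdivrMr// mul1r in Ca.
  apply: lt_le_trans (ler_wpM2r (ltW a0) (hlow n)).
  have h1 : n0.+1%:R * a <= n%:R * a by rewrite ler_wpM2r ?(ltW a0)// ler_nat.
  have h2 : (2 * K + 2) * tb < n%:R * a * tb by rewrite ltr_pM2r// (lt_le_trans Kn0).
  by clear -Ca h2 tb0; lra.
have Kn1 : K < n0.+1%:R * a.
  by apply: le_lt_trans Kn0; rewrite mulr_natl mulr2n -addrA lerDl addr_ge0.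
rewrite (flow_process_integral a0 ht hS f0 fK Kbig) (base_process_integral T H a0 x f0 fK Kn1).
rewrite -sumrB mulr_sumr; apply: (le_trans (ler_norm_sum _ _ _)); apply: ler_sum => i _.
rewrite addn1 -mulrBr normrM (ger0_norm (_ : 0 <= \1_A _))// mulrC ler_wpM2r//.
apply: (le_trans (fL _ _ _)); rewrite ler_wpM2l//.
have St0 : 0 <= (S i.+1 x - t) * a / tb.
  rewrite divr_ge0 ?(ltW tb0)// mulr_ge0 ?(ltW a0)// subr_ge0.
  have [_ /ltW tt] := andP ht; rewrite (le_trans tt)//.
  rewrite (_ : tau x = S 1 x) ?birkhoff_sum_leE//.
  by rewrite /S /birkhoff_sum big_ord1.
rewrite (to_half_lineK St0) to_half_lineK ?mulr_ge0 ?(ltW a0)//.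
rewrite ler_pdivlMr// -[X in _ * X](ger0_norm (ltW tb0)) -normrM.
rewrite (_ : ((S i.+1 x - t) * a / tb - i.+1%:R * a) * tb = (S i.+1 x - i.+1%:R * tb - t) * a); last first.
  by field; rewrite gt_eqF.
rewrite normrM (ger0_norm (ltW a0)) mulrA -mulrDl ler_wpM2r ?(ltW a0)//.
apply: (le_trans (ler_normB _ _)); rewrite (ger0_norm t0).
have h1 := hB i.+1.
have h2 : e * i.+1%:R <= e * n0%:R by rewrite ler_wpM2l// ler_nat.
rewrite (le_trans (lerD h1 tC))// -addrA lerD// mulr_natl mulr2n//.
Qed.

End FlowProcess.

(** * Changing the initial distribution *)

Section LimitMeasurability.
Context (E : ptopologicalType) (R : realType).
Context d' (Om' : measurableType d') (N : Om' -> point_measure E R).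

Import HBNNSimple.

(** The simple functions increasing to [f] do not depend on [w]; their integrals are finite
    combinations of the counts [N w B], and monotone convergence passes to the limit. *)
Lemma measurable_pm_integral (f : test_function E R) :
  (forall B : set (borel E), measurable B -> measurable_fun setT (fun w => N w B)) ->
  (forall z, 0 <= f z) -> measurable_fun setT (fun w => pm_integral (N w) f).
Proof.
move=> mN f0.
have [l lE] := choice (fun w => pm_measure_exists (N w)).
have mf : measurable_fun setT (EFin \o (f : borel E -> R)).
  by apply/measurable_EFinP; apply: continuous_borel_measurable; exact: test_continuous.
pose g := nnsfun_approx measurableT mf.
rewrite (_ : (fun w => _) = fine \o (fun w => \int[l w]_z (f z)%:E)%E); last first.
  by apply/funext => w; rewrite (pm_integral_Rintegral f (lE w)).
apply: measurableT_comp; first exact: fine_measurable.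
have mg n : measurable_fun setT (fun w => \int[l w]_z (g n z)%:E)%E.
  rewrite (_ : (fun w => _) = fun w =>
    (\sum_(r \in range (g n)) r%:E * N w (g n @^-1` [set r]))%E); last first.
    apply/funext => w; rewrite integralT_nnsfun sintegralE.
    by apply: eq_fsbigr => r _; rewrite -lE.
  apply: emeasurable_fsum => // r; apply: measurable_funeM; exact: mN.
have cg w : (\int[l w]_z (g n z)%:E)%E @[n --> \oo] --> (\int[l w]_z (f z)%:E)%E.
  rewrite (_ : (\int[l w]_z (f z)%:E)%E =
      (\int[l w]_z limn (fun n => (g n z)%:E))%E); last first.
    apply: eq_integral => z _; apply/esym/cvg_lim => //.
    by apply: cvg_nnsfun_approx => // y _; rewrite lee_fin.
  apply: cvg_monotone_convergence => //.
  - by move=> n; apply/measurable_EFinP.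
  - by move=> n z _; rewrite lee_fin.
  - by move=> z _ n m nm; rewrite lee_fin; exact/lefP/nd_nnsfun_approx.
refine (@emeasurable_fun_cvg _ _ _ setT _ _ mg (fun w _ => cg w)).
Qed.

End LimitMeasurability.

Section ImageProbability.
Context d d' (X : measurableType d) (Y : measurableType d') (R : realType).
Variables (phi : X -> Y) (mphi : measurable_fun setT phi) (P : probability X R).

Let phi_mfun : {mfun X >-> Y} := HB.pack phi (isMeasurableFun.Build _ _ _ _ phi mphi).

Lemma image_probability_exists : exists P' : probability Y R,
  (forall A, measurable A -> P' A = P (phi @^-1` A)) /\
  (forall (f : Y -> R) (M : R), measurable_fun setT f -> (forall y, `|f y| <= M) ->
    \int[P']_y f y = \int[P]_x f (phi x)).
Proof.
exists (distribution P phi_mfun); split => // f M mf fM.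
rewrite /Rintegral; congr fine.
rewrite integral_pushforward//; first exact/measurable_EFinP.
apply: (@bounded_integrable _ _ _ P (f \o phi) M).
  exact: measurableT_comp.
by move=> x; exact: fM.
Qed.

End ImageProbability.

(** * Insensitivity of the base process to the initial law *)

Section Comparison.
Context d (Om : measurableType d) (R : realType) (mu : probability Om R).
Variables (T : Om -> Om) (V : pmetricType R).
Hypotheses (hT : measure_preserving mu T) (herg : ergodic mu T).
Variable c : nat -> test_function (space_time R V) R.
Hypothesis c0 : forall j z, 0 <= c j z.
Hypothesis cL : forall j, exists L K : R, 0 <= L /\ time_lipschitz (c j) L K.

Lemma uniform_time_lipschitz k : exists L K B : R, [/\ 0 <= L, 0 <= K, 0 <= B &
  forall j, (j < k)%N -> time_lipschitz (c j) L K /\ forall z, `|c j z| <= B].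
Proof.
elim: k => [|k [L [K [B [L0 K0 B0 h]]]]]; first by exists 0, 0, 0; split.
have [L' [K' [L'0 hc]]] := cL k; have [B' B'0 hB'] := test_function_bounded (c k).
exists (L + L'), (Num.max K K'), (B + B'); split; rewrite ?addr_ge0//.
  by rewrite le_max K0.
move=> j; rewrite ltnS leq_eqVlt => /orP[/eqP ->|/h[h1 h2]]; split.
- by apply: time_lipschitzW hc; rewrite ?lerDr// le_max lexx orbT.
- by move=> z; rewrite (le_trans (hB' z))// lerDr.
- by apply: time_lipschitzW h1; rewrite ?lerDl// le_max lexx.
- by move=> z; rewrite (le_trans (h2 z))// lerDl.
Qed.

Let base (A : set Om) (H : Om -> V) := base_process mu T A H.

Lemma measurable_base_cylinder (A : set Om) (H : Om -> V) k L G :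
  measurable A -> measurable_fun A (H : Om -> borel V) -> 0 < fine (mu A) ->
  cylinder_lipschitz c k L G -> measurable_fun setT (G \o base A H).
Proof.
move=> mA mH a0 GL; apply: measurable_cylinder_lipschitz GL => j.
have [L' [K' [_ [_ hK]]]] := cL j.
exact: (measurable_base_process_integral hT mA mH a0 (c0 j) hK).
Qed.

Lemma base_pm_dist_almost_invariant (A : set Om) (H : Om -> V) k (L K B : R) :
  0 <= L -> 0 <= K -> 0 <= B ->
  (forall j, (j < k)%N -> time_lipschitz (c j) L K /\ forall z, `|c j z| <= B) ->
  measurable A -> measurable_fun A (H : Om -> borel V) -> 0 < fine (mu A) ->
  mu.-integrable setT (EFin \o (fun x => pm_dist c k (base A H (T x)) (base A H x))) /\
  \int[mu]_x pm_dist c k (base A H (T x)) (base A H x) <=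
    k%:R * (fine (mu A) * (B + L * K)).
Proof.
move=> L0 K0 B0 + mA mH a0; set a := fine (mu A) in a0 *.
(* The last index with [n0 * a <= K]: the expected number of visits that matter is at most [K],
   whatever [A] is. *)
pose n0 := Num.truncn (K / a).
have Kn0 : K < n0.+1%:R * a by rewrite -ltr_pdivrMr// truncnS_gt.
have n0K : n0%:R * a <= K by rewrite -ler_pdivlMr// truncn_le// divr_ge0// ltW.
elim: k => [|k ih] h.
  rewrite (_ : (fun x => _) = cst 0); last by apply/funext => x; rewrite /pm_dist big_ord0.
  by split; [exact: integrable0|rewrite mul0r /Rintegral integral0].
have [i1 h1] := ih (fun j jk => h j (ltnW jk)).
have [cLK cB] := h k (ltnSn k).
have mc := measurable_base_process_integral hT mA mH a0 (c0 k) cLK.2.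
have i2 : mu.-integrable setT (EFin \o (fun x =>
    `|pm_integral (base A H (T x)) (c k) - pm_integral (base A H x) (c k)|)).
  apply: (@bounded_integrable _ _ _ _ _ (B + L * a * n0%:R)).
    apply: measurableT_comp => //; apply: measurable_funB => //.
    by apply: (measurableT_comp mc); exact: hT.1.
  move=> x; rewrite normr_id.
  rewrite (le_trans (base_process_shift T H a0 x (c0 k) cB L0 cLK Kn0))//.
  rewrite lerD//; first by rewrite indicE; case: (_ \in _); rewrite ?mulr1// mulr0.
  rewrite ler_wpM2l ?mulr_ge0 ?(ltW a0)// (le_trans (ler_norm _))//.
  exact: visit_sum_bounded.
have -> : (fun x => pm_dist c k.+1 (base A H (T x)) (base A H x)) =
    (fun x => pm_dist c k (base A H (T x)) (base A H x) +
      `|pm_integral (base A H (T x)) (c k) - pm_integral (base A H x) (c k)|).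
  by apply/funext => x; rewrite /pm_dist big_ord_recr.
split; first exact: (integrableD measurableT i1 i2).
rewrite RintegralD// -natr1 mulrDl mul1r lerD//.
apply: (@le_trans _ _ (a * (B + L * (n0%:R * a)))).
  exact: (base_process_almost_invariant H hT mA a0 (c0 k) cB L0 cLK Kn0).
by rewrite ler_wpM2l ?(ltW a0)// lerD2l ler_wpM2l.
Qed.

(** The invariance defect of [G] along the base process is at most [q * mu A] with [q] independent
    of [A] and [H], so a small [mu A] puts it below the threshold of [abs_cont_almost_invariant]. *)
Lemma base_abs_cont (nu : probability Om R) k (LG M e : R) G :
  nu `<< mu -> cylinder_lipschitz c k LG G -> (forall N, `|G N| <= M) -> 0 < e ->
  exists2 al, 0 < al & forall (A : set Om) (H : Om -> V),
    measurable A -> measurable_fun A (H : Om -> borel V) ->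
    0 < fine (mu A) -> fine (mu A) <= al ->
    `|\int[nu]_x G (base A H x) - \int[mu]_x G (base A H x)| <= e.
Proof.
move=> numu GL GM e0.
have [dl dl0 hdl] := abs_cont_almost_invariant hT herg M numu e0.
have [L [K [B [L0 K0 B0 hLK]]]] := uniform_time_lipschitz k.
pose q := `|LG| * (k%:R * (B + L * K)).
have q0 : 0 <= q by rewrite !mulr_ge0// addr_ge0// mulr_ge0.
have q1 : 0 < q + 1 by rewrite ltr_wpDl.
exists (dl / (q + 1)); first by rewrite divr_gt0.
move=> A H mA mH a0 aal.
have mG := measurable_base_cylinder mA mH a0 GL.
apply: (hdl (G \o base A H)) => //; first by move=> x; exact: GM.
have [iD hD] := base_pm_dist_almost_invariant L0 K0 B0 hLK mA mH a0.
have mGT : measurable_fun setT (G \o base A H \o T).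
  by apply: (measurableT_comp mG); exact: hT.1.
apply: (@le_trans _ _ (\int[mu]_x (`|LG| * pm_dist c k (base A H (T x)) (base A H x)))).
  apply: le_Rintegral => //.
  - apply: (@bounded_integrable _ _ _ _ _ (M + M)).
      by apply: measurableT_comp => //; exact: measurable_funB.
    by move=> x; rewrite normr_id (le_trans (ler_normB _ _))// lerD//; exact: GM.
  - exact: (integrableZl measurableT _ iD).
  - move=> x _; apply: (le_trans (GL _ _)).
    by rewrite ler_wpM2r ?pm_dist_ge0// ler_norm.
rewrite RintegralZl//; apply: (le_trans (ler_wpM2l (normr_ge0 _) hD)).
rewrite [k%:R * _]mulrCA [`|LG| * _]mulrCA -/q.
apply: (@le_trans _ _ (fine (mu A) * (q + 1))); last by rewrite -ler_pdivlMr.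
by rewrite ler_wpM2l ?(ltW a0)// lerDl.
Qed.

End Comparison.

(** * Changing time *)

Section FlowNull.
Context d (Om : measurableType d) (R : realType) (mu : probability Om R).
Variable tau : Om -> R.
Hypothesis mtau : measurable_fun setT tau.
Variable rho : probability (Om * measurableTypeR R)%type R.
Hypothesis hrho : rho `<< flow_measure mu tau.

Lemma measurable_flow_space : measurable (flow_space tau : set (Om * measurableTypeR R)).
Proof.
rewrite (_ : flow_space tau = [set y | 0 <= y.2] `&` [set y | y.2 < tau y.1]); last first.
  by apply/seteqP; split => [y /andP[]|y [/= h1 h2]] //; apply/andP.
apply: measurableI; rewrite -[X in measurable X]setTI.
  by apply: measurable_fun_ler => //; exact: measurable_snd.
by apply: measurable_fun_ltr => //; exact: (measurableT_comp mtau measurable_fst).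
Qed.

Lemma flow_null (B : set (Om * measurableTypeR R)) : measurable B ->
  (mu \x lebesgue_measure)%E (B `&` flow_space tau) = 0%E -> rho B = 0%E.
Proof.
(* [flow_measure] is a bare set function, so every measurable subset of [B] must be shown null; this
   is done with the product measure. *)
move=> mB B0; apply: (@hrho B _ B mB (@subset_refl _ B)) => A mA AB.
rewrite /flow_measure (_ : (mu \x _)%E _ = 0%E) ?mule0//.
apply/eqP; rewrite -measure_le0 -B0 le_measure ?inE//.
- by apply: measurableI => //; exact: measurable_flow_space.
- by apply: measurableI => //; exact: measurable_flow_space.
- exact: setSI.
Qed.

(** The cylinder over [N] has product measure zero times infinity, that is 0. Hence the base
    marginal of [rho] is absolutely continuous with respect to [mu]. *)
Lemma flow_base_null (N : set Om) : measurable N -> mu N = 0%E -> rho (fst @^-1` N) = 0%E.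
Proof.
move=> mN N0.
have mF : measurable (fst @^-1` N : set (Om * measurableTypeR R)).
  by rewrite -[X in measurable X]setTI; exact: measurable_fst.
apply: flow_null => //; apply/eqP; rewrite -measure_le0.
have NT : (mu \x lebesgue_measure)%E (N `*` [set: measurableTypeR R]) = 0%E.
  transitivity (mu N * lebesgue_measure [set: measurableTypeR R])%E.
    exact: product_measure1E.
  by rewrite N0 mul0e.
rewrite -NT le_measure ?inE//.
- by apply: measurableI => //; exact: measurable_flow_space.
- exact: measurableX.
- by move=> y [].
Qed.

Lemma flow_space_full : rho (~` flow_space tau) = 0%E.
Proof.
apply: flow_null; first by apply: measurableC; exact: measurable_flow_space.
by rewrite setICl measure0.
Qed.

End FlowNull.

(** * Comparison of the flow process with the base process *)

Section FlowComparison.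
Context d (Om : measurableType d) (R : realType) (mu : probability Om R).
Variables (T : Om -> Om) (tau : Om -> R) (V : pmetricType R).
Hypotheses (hT : measure_preserving mu T) (herg : ergodic mu T).
Hypothesis htau : forall x, 0 < tau x.
Hypothesis htauint : mu.-integrable setT (EFin \o tau).
Variable c : nat -> test_function (space_time R V) R.
Hypothesis c0 : forall j z, 0 <= c j z.
Hypothesis cL : forall j, exists L K : R, 0 <= L /\ time_lipschitz (c j) L K.
Variable rho : probability (Om * measurableTypeR R)%type R.
Hypothesis hrho : rho `<< flow_measure mu tau.

Let mtau : measurable_fun setT tau.
Proof. by apply/measurable_EFinP; case/integrableP: htauint. Qed.

(** The points to which [flow_process_close] applies, one [C] bounding both the Birkhoff error and
    the height. *)
Definition roof_set (e : R) (C : nat) : set (Om * measurableTypeR R) :=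
  (fst @^-1` birkhoff_set mu T tau e C) `&` (flow_space tau `&` [set y | y.2 <= C%:R]).

Lemma measurable_roof_set e C : measurable (roof_set e C).
Proof.
apply: measurableI.
  rewrite -[X in measurable X]setTI; apply: measurable_fst => //.
  exact: measurable_birkhoff_set.
apply: measurableI; first exact: measurable_flow_space.
rewrite -[X in measurable X]setTI.
by apply: measurable_fun_ler => //; exact: measurable_snd.
Qed.

Lemma roof_set_exhausts (e e1 : R) : 0 < e -> 0 < e1 ->
  exists C, fine (rho (~` roof_set e C)) < e1.
Proof.
move=> e0 e10; have [N [mN N0] hN] := birkhoff_set_ae hT herg htauint e0.
have mF : measurable (fst @^-1` N : set (Om * measurableTypeR R)).
  by rewrite -[X in measurable X]setTI; exact: measurable_fst.
have mC : measurable (~` flow_space tau : set (Om * measurableTypeR R)).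
  by apply: measurableC; exact: measurable_flow_space.
apply: (@exhaustion_small _ _ _ rho (roof_set e) (fst @^-1` N `|` ~` flow_space tau)) => //.
- exact: measurable_roof_set.
- exact: measurableU.
- rewrite measureU0//; first exact: (flow_base_null mtau hrho mN N0).
  exact: (flow_space_full mtau hrho).
- move=> n m nm y [h1 [h2 /= h3]]; split; first exact: birkhoff_set_nd h1.
  by split => //=; rewrite (le_trans h3)// ler_nat.
- move=> [x t] /not_orP[/hN[C hC] /contrapT ht].
  exists (maxn C (Num.truncn `|t|).+1); split; first by apply: birkhoff_set_nd hC; rewrite leq_maxl.
  split => //=; rewrite (le_trans (ler_norm _))// (le_trans (ltW (truncnS_gt _)))//.
  by rewrite ler_nat leq_maxr.
Qed.

Lemma base_marginal_exists : exists rho1 : probability Om R,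
  [/\ rho1 `<< mu, (forall A, measurable A -> rho1 A = rho (fst @^-1` A)) &
   (forall (f : Om -> R) (M : R), measurable_fun setT f -> (forall y, `|f y| <= M) ->
    \int[rho1]_y f y = \int[rho]_x f x.1)].
Proof.
have [rho1 [h1 h2]] := image_probability_exists (@measurable_fst _ _ Om (measurableTypeR R)) rho.
exists rho1; split => // N N0 A mA AN.
by rewrite h1//; apply: (flow_base_null mtau hrho) => //; exact: N0.
Qed.

(** The pathwise bound is a small time error multiplied by the number of visits. It fails to be
    small only where Birkhoff's bound with constant [C] fails or the visits are too many; both
    events have small [rho]-measure. *)
Lemma flow_base_close k (LG M e : R) G :
  cylinder_lipschitz c k LG G -> (forall N, `|G N| <= M) -> 0 < e ->
  exists2 al, 0 < al & forall (A : set Om) (H : Om -> V),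
    measurable A -> measurable_fun A (H : Om -> borel V) ->
    0 < fine (mu A) -> fine (mu A) <= al ->
    `|\int[rho]_y G (flow_process mu T tau A H y) -
      \int[rho]_y G (base_process mu T A H y.1)| <= e.
Proof.
move=> GL GM e0.
have tb0 := mean_roof_gt0 htau htauint; set tb := mean_roof mu tau in tb0.
have M0 : 0 <= M by apply: le_trans (GM (to_point_measure (fun=> 0%E))).
have M1 : 0 < M + 1 by rewrite ltr_wpDl.
have [rho1 [rho1mu rho1E _]] := base_marginal_exists.
have [L [K [B [L0 K0 B0 hLK]]]] := uniform_time_lipschitz cL k.
pose K2 : R := 2 * K + 2.
have K20 : 0 < K2 by rewrite ltr_wpDl// mulr_ge0.
(* The bad set will have measure at most [2 * e1], which [Rintegral_close] charges with [2 * M]: the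
   total is at most [e / 2]. *)
pose e1 := e / (8 * (M + 1)); have e10 : 0 < e1 by rewrite divr_gt0// mulr_gt0.
have [dl dl0 hdl] := abs_cont_small rho1mu e10.
(* The mean number of visits is at most [K2] under [mu], so by Markov more than [M'] visits have
   [mu]-probability below [dl]. *)
pose M' := K2 / dl + 1; have M'0 : 0 < M' by rewrite addr_gt0// divr_gt0.
pose Q := `|LG| * (k%:R * (L * M')) / tb.
have Q0 : 0 <= Q by rewrite divr_ge0 ?(ltW tb0)// !mulr_ge0// ltW.
have Q1 : 0 < Q + 1 by rewrite ltr_wpDl.
pose e2 := e / (4 * (Q + 1)); have e20 : 0 < e2 by rewrite divr_gt0// mulr_gt0.
(* The first bound keeps the hitting times growing linearly, the second makes the accumulated error
   [e3 * (n0 * a)] at most [e2]. *)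
pose e3 := Num.min (tb / 2) (e2 / K2).
have e30 : 0 < e3 by rewrite lt_min; apply/andP; split; apply: divr_gt0.
have [C hC] := roof_set_exhausts e30 e10.
have C1 : 0 < 2 * C%:R + 1 :> R by rewrite ltr_wpDl// mulr_ge0.
(* [C] is fixed by now, so [mu A] can be taken small against it; the two bounds make [2 * C * a] at
   most the mean roof and at most [e2]. *)
pose al := Num.min (tb / (2 * C%:R + 1)) (e2 / (2 * C%:R + 1)).
exists al => [|A H mA mH a0 aal]; first by rewrite lt_min; apply/andP; split; apply: divr_gt0.
set a := fine (mu A) in a0 aal.
have Ca (r : R) : 0 < r -> a <= r / (2 * C%:R + 1) -> 2 * C%:R * a <= r.
  move=> r0; rewrite ler_pdivlMr// mulrC => h; apply: le_trans h.
  by rewrite ler_wpM2r ?(ltW a0)// lerDl.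
have Catb : 2 * C%:R * a / tb <= 1.
  by rewrite ler_pdivrMr// mul1r; apply: Ca => //; rewrite (le_trans aal)// ge_min lexx.
have Cae2 : 2 * C%:R * a <= e2.
  by apply: Ca => //; rewrite (le_trans aal)// ge_min lexx orbT.
have e3tb : e3 <= tb / 2 by rewrite ge_min lexx.
pose n0 := Num.truncn (K2 / a).
have Kn0 : 2 * K + 2 < n0.+1%:R * a by rewrite -ltr_pdivrMr// truncnS_gt.
have n0K : n0%:R * a <= K2 by rewrite -ler_pdivlMr// truncn_le// divr_ge0// ltW.
have e3K : e3 * (n0%:R * a) <= e2.
  apply: (le_trans (ler_wpM2l (ltW e30) n0K)).
  by rewrite -ler_pdivlMr// ge_min lexx orbT.
pose X x : R := \sum_(n < n0) \1_A (iter (n + 1) T x).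
have X0 x : 0 <= X x by apply: sumr_ge0.
have Xi : mu.-integrable setT (EFin \o X) by exact: integrable_visit_sum hT mA n0 1.
have mX : measurable [set x | M' < X x].
  rewrite -[Y in measurable Y]setTI; apply: measurable_fun_ltr => //.
  exact: measurable_visit_sum hT mA n0 1.
have muX : fine (mu [set x | M' < X x]) < dl.
  apply: (le_lt_trans (markov_fine Xi X0 M'0)).
  rewrite (Rintegral_visit_sum hT mA) ltr_pdivrMr// (le_lt_trans n0K)//.
  by rewrite /M' mulrDr mulr1 mulrC divfK ?gt_eqF// ltrDl.
have rhoX : fine (rho (fst @^-1` [set x | M' < X x])) < e1.
  by rewrite -rho1E//; exact: hdl.
have mFX : measurable (fst @^-1` [set x | M' < X x] : set (Om * measurableTypeR R)).
  by rewrite -[Y in measurable Y]setTI; exact: measurable_fst.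
have mW : measurable (~` roof_set e3 C) by apply: measurableC; exact: measurable_roof_set.
pose Bad := fst @^-1` [set x | M' < X x] `|` ~` roof_set e3 C.
have mBad : measurable Bad by exact: measurableU.
have rhoBad : fine (rho Bad) <= e1 + e1.
  pose B1 : set (Om * measurableTypeR R) := fst @^-1` [set x | M' < X x].
  apply: (@le_trans _ _ (fine (rho B1 + rho (~` roof_set e3 C))%E)).
    rewrite fine_le ?fin_numD ?prob_fin_num//.
    exact: measureU2.
  by rewrite fineD ?prob_fin_num// lerD// ltW.
have mG := measurable_base_cylinder hT c0 cL mA mH a0 GL.
have mG1 : measurable_fun setT
    (fun y : Om * measurableTypeR R => G (base_process mu T A H y.1)).
  exact: (measurableT_comp mG measurable_fst).
have e20' : 0 <= e / 2 by rewrite divr_ge0// ltW.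
have GM1 (y : Om * measurableTypeR R) : `|G (flow_process mu T tau A H y)| <= M by exact: GM.
have GM2 (y : Om * measurableTypeR R) : `|G (base_process mu T A H y.1)| <= M by exact: GM.
have hclose (y : Om * measurableTypeR R) : ~ Bad y ->
    `|G (flow_process mu T tau A H y) - G (base_process mu T A H y.1)| <= e / 2.
  case: y => x t /not_orP[/= /negP]; rewrite -leNgt => hX /contrapT [/= hx [ht tC]].
  apply: (le_trans (GL _ _)).
  apply: (@le_trans _ _ (`|LG| * (k%:R * (L * ((e3 * (n0%:R * a) + 2 * C%:R * a) / tb) * M')))).
    apply: (le_trans (ler_wpM2r (pm_dist_ge0 _ _ _ _) (ler_norm LG))).
    rewrite ler_wpM2l//.
    rewrite /pm_dist mulr_natl -[k in leRHS]card_ord -sumr_const; apply: ler_sum => j _.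
    have [jL _] := hLK j (ltn_ord j).
    apply: (le_trans (flow_process_close H htau htauint a0 ht tC hx (ltW e30) e3tb Catb
      (c0 j) L0 K0 jL Kn0)).
    rewrite ler_wpM2l// mulr_ge0// divr_ge0 ?(ltW tb0)//.
    by rewrite addr_ge0// !mulr_ge0 ?(ltW a0) ?(ltW e30).
  have key (u w S : R) : u * (w * (L * (S / tb) * M')) = u * (w * (L * M')) / tb * S.
    by ring.
  rewrite key -/Q; apply: (le_trans (ler_wpM2l Q0 (lerD e3K Cae2))).
  have : Q * e2 <= e / 4 by apply: mulr_div_add1_le => //; exact: ltW.
  by rewrite mulrDr => h; apply: (le_trans (lerD h h)); rewrite -mulrDl -mulr2n -mulr_natr; lra.
apply: (le_trans (Rintegral_close rho mBad mG1 e20' GM1 GM2 hclose)).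
have h1 : M * e1 <= e / 8 by apply: mulr_div_add1_le => //; exact: ltW.
have h2 : M * fine (rho Bad) <= M * (e1 + e1) by rewrite ler_wpM2l.
move: h1 h2; rewrite mulrDr -mulrA; move: (M * e1) (M * fine _) => p q h1 h2.
rewrite [leRHS]splitr lerD2l.
have h3 : q <= e / 8 + e / 8 by rewrite (le_trans h2)// lerD.
rewrite (le_trans (ler_wpM2l _ h3))// le_eqVlt; apply/orP; left; apply/eqP.
by field.
Qed.

End FlowComparison.

(** * The limit theorem *)

Lemma bounded_convergence d (T : measurableType d) (R : realType) (P : probability T R)
    (g : nat -> T -> R) (h : T -> R) (M : R) :
  (forall n, measurable_fun setT (g n)) -> (forall n x, `|g n x| <= M) ->
  (forall x, g n x @[n --> \oo] --> h x) ->
  \int[P]_x g n x @[n --> \oo] --> \int[P]_x h x.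
Proof.
move=> mg gM gh.
have mh : measurable_fun setT h by exact: (measurable_fun_cvg mg (fun x _ => gh x)).
have [] := @dominated_convergence _ _ _ P setT measurableT
    (fun n => EFin \o g n) (EFin \o h) (EFin \o (fun=> M)).
- by move=> n; exact/measurable_EFinP.
- exact/measurable_EFinP.
- by apply: nearW => x _; apply: cvg_EFin; [exact: nearW|exact: gh].
- exact: (@bounded_integrable _ _ _ _ _ `|M|).
- by apply: nearW => x n _ /=; rewrite lee_fin.
move=> hi _; rewrite -[X in _ --> X -> _]fineK; last exact: integrable_fin_num.
by move=> /fine_cvgP[_].
Qed.

Section Expectation.
Context d (T : measurableType d) (R : realType) (P : probability T R).

Lemma expectation_bounded (f : T -> R) (M : R) : (forall x, `|f x| <= M) ->
  ('E_P[f])%E = (\int[P]_x f x)%:E.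
Proof.
move=> fM; rewrite unlock /Rintegral fineK//.
exact: bounded_integral_fin_num fM.
Qed.

End Expectation.

Section Main.
Context d (Om : measurableType d) (R : realType) (mu : probability Om R).
Variables (T : Om -> Om) (tau : Om -> R) (V : pmetricType R).
Hypotheses (hT : measure_preserving mu T) (herg : ergodic mu T).
Hypothesis htau : forall x, 0 < tau x.
Hypothesis htauint : mu.-integrable setT (EFin \o tau).
Variables (A : R -> set Om) (H : R -> Om -> V).
Hypothesis hA : forall e, 0 < e -> measurable (A e).
Hypothesis hA0 : fine (mu (A e)) @[e --> 0^'+] --> 0^'+.
Hypothesis hH : forall e, 0 < e -> measurable_fun (A e) (H e : Om -> borel V).
Context d' (Om' : measurableType d') (Q : probability Om' R).
Variable N : Om' -> point_measure (space_time R V) R.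
Hypothesis mN : forall B : set (borel (space_time R V)), measurable B ->
  measurable_fun setT (fun w => N w B).
Variables (mut : probability Om R).
Hypothesis hmut : mut `<< mu.
Hypothesis hcvg : cvg_in_distribution mut (fun e => base_process mu T (A e) (H e)) Q N.
Variable rho : probability (Om * measurableTypeR R)%type R.
Hypothesis hrho : rho `<< flow_measure mu tau.
Variable c : nat -> test_function (space_time R V) R.
Hypothesis cD : determining c.
Hypothesis cL : forall j, exists L K : R, 0 <= L /\ time_lipschitz (c j) L K.

Let c0 : forall j z, 0 <= c j z. Proof. by case: cD. Qed.

Lemma cylinder_flow_cvg k (L M : R) G : cylinder_lipschitz c k L G ->
  (forall p, `|G p| <= M) ->
  \int[rho]_y G (flow_process mu T tau (A e) (H e) y) @[e --> 0^'+] -->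
  \int[Q]_w G (N w).
Proof.
move=> GL GM; apply/cvgrPdist_le => e e0.
have e4 : 0 < e / 4 by rewrite divr_gt0.
have [rho1 [rho1mu _ rho1I]] := base_marginal_exists htauint hrho.
have [al1 al10 h1] := base_abs_cont hT herg c0 cL rho1mu GL GM e4.
have [al2 al20 h2] := base_abs_cont hT herg c0 cL hmut GL GM e4.
have [al3 al30 h3] := flow_base_close hT herg htau htauint c0 cL hrho GL GM e4.
have cvgG : \int[mut]_x G (base_process mu T (A r) (H r) x) @[r --> 0^'+] --> \int[Q]_w G (N w).
  have := hcvg (cylinder_lipschitz_continuous GL) (ex_intro _ M GM).
  rewrite (expectation_bounded Q (f := G \o N) (M := M)); last by move=> w; exact: GM.
  under eq_fun do rewrite (expectation_bounded mut (M := M) (fun x => GM _)).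
  by move=> /fine_cvgP[_].
(* Convergence to [0^'+] gives eventual positivity of [mu (A r)] as well as its smallness. *)
have n0 : \forall r \near 0^'+, 0 < fine (mu (A r)) by exact: (hA0 (nbhs_right_gt 0)).
have n1 : \forall r \near 0^'+, fine (mu (A r)) <= al1 by exact: (hA0 (nbhs_right_le al10)).
have n2 : \forall r \near 0^'+, fine (mu (A r)) <= al2 by exact: (hA0 (nbhs_right_le al20)).
have n3 : \forall r \near 0^'+, fine (mu (A r)) <= al3 by exact: (hA0 (nbhs_right_le al30)).
near=> r.
have r0 : 0 < r by near: r; exact: nbhs_right_gt.
have a0 : 0 < fine (mu (A r)) by near: r.
have a1 : fine (mu (A r)) <= al1 by near: r.
have a2 : fine (mu (A r)) <= al2 by near: r.
have a3 : fine (mu (A r)) <= al3 by near: r.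
have mA := hA r0; have mH := hH r0.
have {}h1 := h1 _ _ mA mH a0 a1.
have {}h2 := h2 _ _ mA mH a0 a2.
have {}h3 := h3 _ _ mA mH a0 a3.
have h4 : `|\int[Q]_w G (N w) - \int[mut]_x G (base_process mu T (A r) (H r) x)| <= e / 4.
  by near: r; exact: (cvgr_dist_le _ _ cvgG).
have mG := measurable_base_cylinder hT c0 cL mA mH a0 GL.
have E1 := rho1I (G \o base_process mu T (A r) (H r)) M mG (fun x => GM _).
rewrite /= in E1; rewrite -E1 in h3.
move: h1 h2 h3 h4; rewrite !ler_norml.
move: (\int[rho1]_x _) (\int[mu]_x _) (\int[mut]_x _) (\int[Q]_x _) (\int[rho]_x _) => u1 u2 u3 u4 u5.
move=> /andP[? ?] /andP[? ?] /andP[? ?] /andP[? ?].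
by clear a0 a1 a2 a3 E1; apply/andP; split; lra.
Unshelve. all: by end_near. Qed.

Lemma envelope_limit_cvg F (M : R) : continuous F -> (forall p, `|F p| <= M) ->
  \int[Q]_w envelope c F k (N w) @[k --> \oo] --> \int[Q]_w F (N w).
Proof.
move=> cF FM; apply: (@bounded_convergence _ _ _ Q (fun k w => envelope c F k (N w)) (F \o N) M).
- move=> k; apply: (measurable_cylinder_lipschitz _ (envelope_lipschitz c FM k)) => j.
  exact: measurable_pm_integral.
- by move=> k w; exact: envelope_bounded.
- by move=> w; exact: (@envelope_cvg _ _ c F M FM (N w) cD cF).
Qed.

(** [F] lies between its own envelope and the opposite of the envelope of its opposite. Their
    indices are fixed first so that both means under [Q] are close to that of [F]; only then does
    the parameter tend to 0. *)
Lemma flow_cvg : cvg_in_distribution rho (fun e => flow_process mu T tau (A e) (H e)) Q N.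
Proof.
move=> F cF [M FM].
rewrite (expectation_bounded Q (f := F \o N) (M := M)); last by move=> w; exact: FM.
under eq_fun do rewrite (expectation_bounded rho (M := M) (fun x => FM _)).
apply: cvg_EFin; first exact: nearW.
pose F' p := - F p.
have cF' : continuous F' by move=> p; exact: (@cvgN _ _ _ _ (nbhs_filter p) F (F p) (cF p)).
have F'M p : `|F' p| <= M by rewrite normrN.
have F'cvg : \int[Q]_w - envelope c F' k (N w) @[k --> \oo] --> \int[Q]_w F (N w).
  apply: (@bounded_convergence _ _ _ Q (fun k w => - envelope c F' k (N w)) (F \o N) M).
  - move=> k; apply: measurableT_comp => //.
    apply: (measurable_cylinder_lipschitz _ (envelope_lipschitz c F'M k)) => j.
    exact: measurable_pm_integral.
  - by move=> k w; rewrite normrN; exact: envelope_bounded.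
  - move=> w; rewrite -[X in _ --> X]opprK; apply: cvgN.
    exact: (@envelope_cvg _ _ c F' M F'M (N w) cD cF').
apply/cvgrPdist_le => /= e e0; have e2 : 0 < e / 2 by rewrite divr_gt0.
have [k hk] : exists k, `|\int[Q]_w F (N w) - \int[Q]_w envelope c F k (N w)| <= e / 2.
  have /cvgrPdist_le/(_ _ e2)[k _ h] := envelope_limit_cvg cF FM.
  by exists k; exact: (h k (leqnn k)).
have [k' hk'] : exists k', `|\int[Q]_w F (N w) - \int[Q]_w - envelope c F' k' (N w)| <= e / 2.
  have /cvgrPdist_le/(_ _ e2)[k' _ h] := F'cvg.
  by exists k'; exact: (h k' (leqnn k')).
have lowM p : `|envelope c F k p| <= M by exact: envelope_bounded.
have upM p : `|- envelope c F' k' p| <= M by rewrite normrN; exact: envelope_bounded.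
have lowL := envelope_lipschitz c FM k.
have upL : cylinder_lipschitz c k' k'%:R (fun p => - envelope c F' k' p).
  by move=> p p'; rewrite -opprD normrN; exact: (envelope_lipschitz c F'M).
have /cvgrPdist_le/(_ _ e2) nlow := cylinder_flow_cvg lowL lowM.
have /cvgrPdist_le/(_ _ e2) nup := cylinder_flow_cvg upL upM.
near=> r.
have hlow : `|\int[Q]_w envelope c F k (N w) -
  \int[rho]_y envelope c F k (flow_process mu T tau (A r) (H r) y)| <= e / 2 by near: r.
have hup : `|\int[Q]_w - envelope c F' k' (N w) -
  \int[rho]_y - envelope c F' k' (flow_process mu T tau (A r) (H r) y)| <= e / 2 by near: r.
(* Monotonicity on arbitrary bounded functions: [F] of the flow process enters the argument only
   here and in [le_up]. *)
have ge_low : \int[rho]_y envelope c F k (flow_process mu T tau (A r) (H r) y) <=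
    \int[rho]_y F (flow_process mu T tau (A r) (H r) y).
  apply: (@le_Rintegral_all _ _ _ _ _ _ M) => y; [exact: lowM|exact: FM|].
  exact: (envelope_le c FM).
have le_up : \int[rho]_y F (flow_process mu T tau (A r) (H r) y) <=
    \int[rho]_y - envelope c F' k' (flow_process mu T tau (A r) (H r) y).
  apply: (@le_Rintegral_all _ _ _ _ _ _ M) => y; [exact: FM|exact: upM|].
  by rewrite lerNr; exact: (envelope_le c F'M).
move: hk hk' hlow hup ge_low le_up; rewrite !ler_norml.
set u1 := \int[Q]_w F (N w); set u2 := \int[Q]_w envelope c F k (N w).
set u3 := \int[Q]_w - envelope c F' k' (N w).
set u4 := \int[rho]_y F (flow_process mu T tau (A r) (H r) y).
set u5 := \int[rho]_y envelope c F k (flow_process mu T tau (A r) (H r) y).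
set u6 := \int[rho]_y - envelope c F' k' (flow_process mu T tau (A r) (H r) y).
clearbody u1 u2 u3 u4 u5 u6.
move=> /andP[? ?] /andP[? ?] /andP[? ?] /andP[? ?] ? ?.
by apply/andP; split; lra.
Unshelve. all: by end_near. Qed.

End Main.

Theorem theorem2p3 (R : realType)
    (d : measure_display) (Om : measurableType d) (mu : probability Om R)
    (T : Om -> Om) (tau : Om -> R)
    (hT : measure_preserving mu T)
    (herg : ergodic mu T)
    (htau : forall x, 0 < tau x)
    (htauint : mu.-integrable setT (EFin \o tau))
    (V : pmetricType R)
    (hVlc : locally_compact [set: V])
    (hVsc : @second_countable V)
    (calA : R -> set (Om * R))
    (A := fun e : R => fst @` calA e)
    (hcalA : forall e, 0 < e -> calA e `<=` flow_space tau)
    (hA : forall e, 0 < e -> measurable (A e))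
    (hA0 : fine (mu (A e)) @[e --> 0^'+] --> 0^'+)
    (H : R -> Om -> V)
    (hH : forall e, 0 < e -> measurable_fun (A e) (H e : Om -> borel V))
    (m : {measure set (borel V) -> \bar R})
    (d' : measure_display) (Om' : measurableType d') (Q : probability Om' R)
    (N : Om' -> point_measure (space_time R V) R)
    (hN : poisson_point_process Q N (space_time_intensity m))
    (mut : probability Om R)
    (hmut : mut `<< mu)
    (hcvg : cvg_in_distribution mut
              (fun e => base_process mu T (A e) (H e)) Q N) :
  cvg_strongly_in_distribution (flow_measure mu tau)
    (fun e => flow_process mu T tau (A e) (H e)) Q N.
Proof.
(* Second countability provides the centres of the tents, local compactness their compact
   supports. *)
move=> rho hrho; have [v_ v_dense] := second_countable_dense hVsc.
have [c [cD cL]] := determining_tents v_dense hVlc.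
have mN (B : set (borel (space_time R V))) : measurable B ->
  measurable_fun setT (fun w => N w B) by move=> mB; exact: (hN.1 B mB).1.
exact: (flow_cvg hT herg htau htauint hA hA0 hH mN hmut hcvg hrho cD cL).
Qed.
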